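(* Consider the process on the unit sphere $\mathbb{S}^2\subset\mathbb{R}^3$ given by $$\mathrm{d}X = -\breve\Omega(t)\times X\,\mathrm{d}t-\gamma^2X\,\mathrm{d}t+\gamma X\times\mathrm{d}W,$$ and the von Mises--Fisher family $p_\theta(x)=\exp(\theta^{\mathsf T}x-\kappa(\|\theta\|))$, $\theta\in\mathbb{R}^3$, of densities on $\mathbb{S}^2$, where $\kappa(r)=-\log r+\log(4\pi)+\log\sinh r$. Let $\theta_F(t)$ be the parameter curve of the von Mises--Fisher projection filter. Then the von Mises--Fisher projection smoother is given by $$\dot\theta_S=-\breve\Omega(t)\times\theta_S-\frac{\gamma^2\kappa'(\|\theta_S\|)}{\|\theta_S\|\,\kappa''(\|\theta_S\|)}\,\theta_S+G(\theta_S)\big(\theta_S-\theta_F\big),$$ where $$G(\theta)=\frac{\gamma^2\|\theta\|}{\kappa'(\|\theta\|)}P_\perp(\theta)+\frac{\gamma^2[1-(\kappa'(\|\theta\|))^2]}{\kappa''(\|\theta\|)}P(\theta)-\gamma^2\mathrm{I},$$ with $P(\theta)=\theta\theta^{\mathsf T}/\|\theta\|^2$ and $P_\perp(\theta)=\mathrm{I}-P(\theta)$.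
   Context: $\times$ is the vector cross product on $\mathbb{R}^3$, $\breve\Omega(t)\in\mathbb{R}^3$ is a given function of time, $\gamma$ is a real constant, $W$ is a standard Wiener process on $\mathbb{R}^3$, and $X(0)\in\mathbb{S}^2$ (then $X(t)\in\mathbb{S}^2$ for $t>0$). With $Q(x)=\gamma^2(\mathrm{I}\|x\|^2-xx^{\mathsf T})$, the generator of $X$ is $$\mathcal{G}[\phi]=-(\breve\Omega(t)\times x+\gamma^2x)^{\mathsf T}\nabla_x\phi+\frac12\operatorname{tr}[Q\nabla_x^2\phi].$$ The base measure $\lambda$ on $\mathbb{S}^2$ is the uniform (surface area, total mass $4\pi$) measure, and $\mathcal{G}^a$ is the (formal) adjoint of $\mathcal{G}$ in $\mathcal{L}_2(\mathbb{S}^2,\lambda)$. The formulas are read for $\theta\neq 0$. Projection filter and smoother: for a parametric family $\{p_\theta\}$ of densities with Fisher information matrix $g(\theta)$, the tangent space at $\sqrt{p_\theta}$ is $\operatorname{span}\{\partial_{\theta_i}\sqrt{p_\theta}\}$, with $\langle\partial_{\theta_i}\sqrt{p_\theta},\partial_{\theta_j}\sqrt{p_\theta}\rangle=\frac14g_{i,j}(\theta)$, and the orthogonal projection of $\mathcal{L}_2(\mathbb{S}^2,\lambda)$ onto it is $\Pi_\theta v=4\sum_{i,j}g^{-1}_{i,j}(\theta)\langle v,\partial_{\theta_j}\sqrt{p_\theta}\rangle\,\partial_{\theta_i}\sqrt{p_\theta}$. The filter parameter $\theta_F$ evolves between measurements by $\partial_t\sqrt{p_{\theta_F}}=\Pi_{\theta_F}\big[\tfrac{1}{2\sqrt{p_{\theta_F}}}\mathcal{G}^a[p_{\theta_F}]\big]$;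 for the smoother it is a given curve. The projection smoother is the parameter curve $\theta_S(t)$ determined by $$\partial_t\sqrt{p_{\theta_S}}=\Pi_{\theta_S}\circ\widehat{\mathcal{B}}^{1/2}[\sqrt{p_{\theta_S}}],\qquad\widehat{\mathcal{B}}^{1/2}[\phi]=\frac{\phi}{2\phi^2}\Big(\frac{\phi^2}{p_{\theta_F}}\mathcal{G}^a[p_{\theta_F}]-p_{\theta_F}\mathcal{G}\Big[\frac{\phi^2}{p_{\theta_F}}\Big]\Big).$$ *)

(* Defs.v *)
From mathcomp Require Import all_boot all_order all_algebra.
From mathcomp Require Import all_classical all_reals all_analysis.
From mathcomp Require Import ring.

Set Implicit Arguments.
Unset Strict Implicit.
Unset Printing Implicit Defensive.
Import Order.TTheory GRing.Theory Num.Theory.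
Import numFieldNormedType.Exports.
Local Open Scope classical_set_scope.
Local Open Scope ring_scope.

Section R3.
Context {R : realType}.
Implicit Types (u v x : 'cV[R]_3) (f : 'cV[R]_3 -> R).

Definition dotv u v : R := (u^T *m v) 0 0.

(* The library norm `|x| on matrices is the sup norm. *)
Definition enorm x : R := Num.sqrt (dotv x x).

Definition crossv u v : 'cV[R]_3 :=
  \col_i [:: u 1 0 * v 2 0 - u 2 0 * v 1 0;
             u 2 0 * v 0 0 - u 0 0 * v 2 0;
             u 0 0 * v 1 0 - u 1 0 * v 0 0]`_i.

Definition partial (i : 'I_3) f x : R := 'D_(delta_mx i 0) f x.

Definition grad f x : 'cV[R]_3 := \col_i partial i f x.

Definition hess f x : 'M[R]_3 := \matrix_(i, j) partial i (partial j f) x.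

Definition C1 f : Prop :=
  (forall i x, derivable f x (delta_mx i 0)) /\
  (forall i, continuous (partial i f)).

Definition C2 f : Prop := C1 f /\ forall i, C1 (partial i f).

End R3.

(* Functions on the sphere are represented by functions on R^3, of which only
   the values on the sphere matter; every C^2 function on the sphere is the
   restriction of a C^2 function on R^3. The uniform measure is the surface area
   sin(u.1) du.1 du.2 in spherical coordinates (polar angle u.1, azimuth u.2). *)
Section Sphere.
Context {R : realType}.
Implicit Types (x : 'cV[R]_3) (f g : 'cV[R]_3 -> R) (u : R * R).

Definition sphere : set 'cV[R]_3 := [set x | enorm x = 1].

Definition sphere_pt u : 'cV[R]_3 :=
  \col_i [:: sin u.1 * cos u.2; sin u.1 * sin u.2; cos u.1]`_i.

Definition sphere_chart : set (R * R) := `[0, pi] `*` `[0, 2 * pi].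

Definition sphere_int f : R :=
  \int[(lebesgue_measure \x lebesgue_measure)%E]_(u in sphere_chart)
    (f (sphere_pt u) * sin u.1).

Definition sphere_L2 f : Prop :=
  measurable_fun sphere_chart (f \o sphere_pt) /\
  (lebesgue_measure \x lebesgue_measure)%E.-integrable sphere_chart
    (fun u => (f (sphere_pt u) ^+ 2 * sin u.1)%:E).

Definition inner f g : R := sphere_int (fun x => f x * g x).

Definition formal_adjoint (L La : ('cV[R]_3 -> R) -> ('cV[R]_3 -> R)) : Prop :=
  (forall f, C2 f -> sphere_L2 (La f)) /\
  (forall f g, C2 f -> C2 g -> inner (L f) g = inner f (La g)).

End Sphere.

(* The Ito equation dX = - Omega x X dt - gamma^2 X dt + gamma X x dW enters
   only through its coefficients: drift, dispersion matrix, and generator. *)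
Section Process.
Context {R : realType}.
Variables (Omega : R -> 'cV[R]_3) (gamma : R).
Implicit Types (t : R) (x : 'cV[R]_3).

Definition drift t x : 'cV[R]_3 := - (crossv (Omega t) x + gamma ^+ 2 *: x).

Definition dispersion x : 'M[R]_3 :=
  \matrix_(i, j) (gamma * crossv x (delta_mx j 0) i 0).

Definition diffusion x : 'M[R]_3 :=
  gamma ^+ 2 *: ((enorm x ^+ 2)%:M - x *m x^T).

Let sum3 (F : 'I_3 -> R) : \sum_i F i = F 0 + F 1 + F 2.
Proof.
rewrite !big_ord_recl big_ord0 addr0 addrA.
by congr (F _ + F _ + F _); apply: val_inj.
Qed.

Let ord3P (P : 'I_3 -> Prop) : P 0 -> P 1 -> P 2 -> forall i, P i.
Proof.
move=> P0 P1 P2 [[|[|[|//]]] Hi].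
- by rewrite (_ : Ordinal _ = 0) //; apply: val_inj.
- by rewrite (_ : Ordinal _ = 1) //; apply: val_inj.
- by rewrite (_ : Ordinal _ = 2) //; apply: val_inj.
Qed.

Lemma dispersion_mul x w : dispersion x *m w = gamma *: crossv x w.
Proof.
apply/colP; apply: ord3P; rewrite !mxE !sum3 !mxE /=; ring.
Qed.

Lemma dispersion_sq x : dispersion x *m (dispersion x)^T = diffusion x.
Proof.
have xx : enorm x ^+ 2 = x 0 0 ^+ 2 + x 1 0 ^+ 2 + x 2 0 ^+ 2.
  have -> : x 0 0 ^+ 2 + x 1 0 ^+ 2 + x 2 0 ^+ 2 = dotv x x.
    by rewrite /dotv mxE sum3 !mxE !expr2.
  by rewrite sqr_sqrtr // /dotv mxE sumr_ge0 // => i _; rewrite mxE -expr2 sqr_ge0.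
apply/matrixP; apply: ord3P; apply: ord3P;
  rewrite /diffusion xx !mxE !sum3 !mxE /= big_ord1 !mxE /=; ring.
Qed.



Definition generator t (f : 'cV[R]_3 -> R) x : R :=
  dotv (drift t x) (grad f x) + 2^-1 * \tr (diffusion x *m hess f x).

End Process.

Section Projection.
Context {R : realType}.
(* p theta x is the density at x of the member of the family at theta *)
Variable p : 'cV[R]_3 -> 'cV[R]_3 -> R.
Implicit Types (th x : 'cV[R]_3) (f v : 'cV[R]_3 -> R).

Definition sqrtp th x : R := Num.sqrt (p th x).

Definition dsqrtp (i : 'I_3) th x : R := partial i (sqrtp ^~ x) th.

Definition score (i : 'I_3) th x : R := partial i (fun th' => ln (p th' x)) th.

Definition fisher th : 'M[R]_3 :=
  \matrix_(i, j) sphere_int (fun x => score i th x * score j th x * p th x).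

Definition proj th v x : R :=
  4 * \sum_i \sum_j invmx (fisher th) i j * inner v (dsqrtp j th) * dsqrtp i th x.

Variables (G Ga : R -> ('cV[R]_3 -> R) -> ('cV[R]_3 -> R)).

(* Equations between square-root densities hold pointwise on the sphere; the open
   interval ]a, b[ lies between two consecutive measurement times. *)
Definition projection_filter (a b : R) (thF : R -> 'cV[R]_3) : Prop :=
  forall t, t \in `]a, b[ -> forall x, sphere x ->
    is_derive t 1 (fun s => sqrtp (thF s) x)
      (proj (thF t) (fun y => (2 * sqrtp (thF t) y)^-1 * Ga t (p (thF t)) y) x).

Definition Bhalf t thF f x : R :=
  let w y := f y ^+ 2 / p thF y in
  f x / (2 * f x ^+ 2) * (w x * Ga t (p thF) x - p thF x * G t w x).

Definition projection_smoother (a b : R) (thF thS : R -> 'cV[R]_3) : Prop :=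
  forall t, t \in `]a, b[ -> forall x, sphere x ->
    is_derive t 1 (fun s => sqrtp (thS s) x)
      (proj (thS t) (Bhalf t (thF t) (sqrtp (thS t))) x).

End Projection.

Section VonMisesFisher.
Context {R : realType}.
Implicit Types (r gamma : R) (th x : 'cV[R]_3).

Definition sinh r : R := (expR r - expR (- r)) / 2.

Definition kappa r : R := - ln r + ln (4 * pi) + ln (sinh r).

Definition vmf th x : R := expR (dotv th x - kappa (enorm th)).

Definition Ppar th : 'M[R]_3 := (enorm th ^+ 2)^-1 *: (th *m th^T).

Definition Pperp th : 'M[R]_3 := 1%:M - Ppar th.

Definition gain gamma th : 'M[R]_3 :=
  let r := enorm th in
  (gamma ^+ 2 * r / derive1 kappa r) *: Pperp th
  + (gamma ^+ 2 * (1 - derive1 kappa r ^+ 2) / derive1n 2 kappa r) *: Ppar th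
  - (gamma ^+ 2)%:M.

End VonMisesFisher.

(* Main.v *)
Require Import Defs.
From mathcomp Require Import all_boot all_order all_algebra.
From mathcomp Require Import all_classical all_reals all_analysis.
From mathcomp Require Import measurable_realfun.
From mathcomp Require Import ring lra.
Set Implicit Arguments.
Unset Strict Implicit.
Unset Printing Implicit Defensive.
Import Order.TTheory GRing.Theory Num.Theory.
Import numFieldNormedType.Exports.
Local Open Scope classical_set_scope.
Local Open Scope ring_scope.

(* Write p for the density at theta_S and d = theta_S - theta_F. By adjointness
   and the Leibniz rule for the second order operator G, the inner product of
   the smoother field with the j-th derivative of sqrt p is one quarter of the
   p-expectation of G x_j + gamma^2 (d_j - x_j (x.d)). Projecting multiplies
   this vector by the inverse Fisher matrix, so only the first two moments of p
   are needed. Integration by parts in spherical coordinates shows that the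
   rotation fields have integral zero against the surface measure; applied to
   exp(theta.x) and x_i exp(theta.x) this expresses both moments through
   E x = a theta. For the normalization, z(s), the integral of exp(s theta.x),
   solves s z'' + 2 z' = s |theta|^2 z, so s z(s) is a multiple of
   sinh (s |theta|). *)

(** The ratio p_S / p_F of two members of the family is a constant times exp(d.x), so [Bhalf]
    applies the generator only to the exponential of a linear function; every integrand without [Ga]
    then stays in one class closed under the generator. [Ga] is known only through its pairing and
    its square integrability on C^2 arguments, so it must be removed before anything can be
    computed. Rotation fields suit the integration by parts because they are tangent to the sphere
    and preserve its measure: ambient partial derivatives suffice and no surface gradient has to be
    defined. The equation for z is singular at s = 0, but the one for s z(s) is not, and its zero at
    s = 0 selects sinh. In the equivalence, one direction must obtain the differentiability of
    theta_S from that of the square-root densities. The values of log p at the antipodal points e_i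
    and -e_i differ by 2 theta_i, since kappa cancels, so two points of the sphere recover each
    coordinate. *)

Section Coordinates.
Context {R : realType}.
Implicit Types (u v x : 'cV[R]_3).

Lemma sum3 (V : nmodType) (F : 'I_3 -> V) : \sum_i F i = F 0 + F 1 + F 2.
Proof.
rewrite !big_ord_recl big_ord0 addr0 addrA.
by congr (F _ + F _ + F _); apply: val_inj.
Qed.

Lemma ord3P (P : 'I_3 -> Prop) : P 0 -> P 1 -> P 2 -> forall i, P i.
Proof.
move=> P0 P1 P2 [[|[|[|//]]] Hi].
- by rewrite (_ : Ordinal _ = 0) //; apply: val_inj.
- by rewrite (_ : Ordinal _ = 1) //; apply: val_inj.
- by rewrite (_ : Ordinal _ = 2) //; apply: val_inj.
Qed.

Lemma dotvE u v : dotv u v = u 0 0 * v 0 0 + u 1 0 * v 1 0 + u 2 0 * v 2 0.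
Proof. by rewrite /dotv mxE sum3 !mxE. Qed.

Lemma sum3_delta i u :
  (i == 0)%:R * u 0 0 + (i == 1)%:R * u 1 0 + (i == 2)%:R * u 2 0 = u i 0.
Proof. by move: i; apply: ord3P => /=; rewrite !(mul0r, mul1r, addr0, add0r). Qed.

Lemma dotv_ge0 x : 0 <= dotv x x.
Proof. by rewrite dotvE !addr_ge0// -expr2 sqr_ge0. Qed.

Lemma dotv_gt0 x : x != 0 -> 0 < dotv x x.
Proof.
rewrite lt_neqAle dotv_ge0 andbT eq_sym => /negP x0; apply/negP => /eqP xx.
have sq0 (y : R) : y ^+ 2 = 0 -> y = 0.
  by move=> /eqP; rewrite sqrf_eq0 => /eqP.
apply: x0; apply/eqP/matrixP => i j; rewrite ord1 mxE.
move: xx; rewrite dotvE -!expr2 => xx.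
have [s0 s1 s2] : [/\ 0 <= x 0 0 ^+ 2, 0 <= x 1 0 ^+ 2 & 0 <= x 2 0 ^+ 2].
  by rewrite !sqr_ge0.
by move: i; apply: ord3P; apply/esym/sq0; lra.
Qed.

Lemma enorm_gt0 x : x != 0 -> 0 < enorm x.
Proof. by move=> x0; rewrite sqrtr_gt0 dotv_gt0. Qed.

Lemma sqr_enorm x : enorm x ^+ 2 = dotv x x.
Proof. by rewrite sqr_sqrtr// dotv_ge0. Qed.

Lemma sphere_dotv x : sphere x -> dotv x x = 1.
Proof. by rewrite /sphere/= -sqr_enorm => ->; rewrite expr1n. Qed.

End Coordinates.

(** * Gradients and a class of functions closed under differentiation *)

Section Elementary.
Context {R : realType}.
Implicit Types (f g : 'cV[R]_3 -> R) (x : 'cV[R]_3).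

(* Hadamard differentiability: the chain rule along every differentiable
   curve through [x]. *)
Definition has_grad f x (d : 'cV[R]_3) : Prop :=
  forall (c : R -> 'cV[R]_3) (t : R) v, c t = x -> is_derive t 1 c v ->
    is_derive t 1 (fun s => f (c s)) (dotv d v).

Lemma is_derive_colP (c : R -> 'cV[R]_3) (t : R) (v : 'cV[R]_3) :
  is_derive t 1 c v <-> forall i, is_derive t 1 (fun s => c s i 0) (v i 0).
Proof.
split=> [cv i|cv].
  have [dc ec] := cv.
  split; first by have /derivable_mxP := dc; exact.
  by have := derive_mx dc; rewrite ec => ->; rewrite mxE.
have dc : derivable c t 1.
  by apply/derivable_mxP => i j; rewrite ord1; have [] := cv i.
split=> //; rewrite derive_mx//; apply/matrixP => i j; rewrite mxE ord1.
by have [] := cv i.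
Qed.

Lemma is_derive_line (f : 'cV[R]_3 -> R) x v d :
  is_derive (0 : R) 1 (fun h => f (h *: v + x)) d -> is_derive x v f d.
Proof.
have E : (fun h : R => h^-1 *: (f (h *: v + x) - f x)) =
   (fun h : R => h^-1 *: (f ((h *: 1 + 0) *: v + x) - f (0 *: v + x))).
  by apply/funext => h; rewrite scale0r add0r /GRing.scale/= mulr1 addr0.
by case=> df ef; split; rewrite /derivable /derive /= E.
Qed.

Lemma has_grad_partial f x d i : has_grad f x d ->
  is_derive x (delta_mx i 0) f (d i 0).
Proof.
move=> fd; apply: is_derive_line.
have -> : d i 0 = dotv d (delta_mx i 0).
  by rewrite dotvE !mxE; move: i; apply: ord3P => /=;
    rewrite !(mulr0, mulr1, addr0, add0r).
apply: fd; first by rewrite scale0r add0r.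
apply/is_derive_colP => k.
have -> : (fun s : R => (s *: (delta_mx i 0 : 'cV[R]_3) + x) k 0) =
  (fun s => s * (delta_mx i 0 : 'cV[R]_3) k 0 + x k 0).
  by apply/funext => s; rewrite !mxE.
by apply: is_derive_eq; rewrite /GRing.scale/= !(mulr0, mulr1, addr0, add0r).
Qed.

Lemma has_grad_cst c x : has_grad (fun=> c) x 0.
Proof. by move=> ? t v _ _; apply: is_derive_eq; rewrite dotvE !mxE !mul0r !addr0. Qed.

Lemma has_grad_coord i x : has_grad (fun y => y i 0) x (delta_mx i 0).
Proof.
move=> c t v _ /is_derive_colP cv; apply: is_derive_eq.
by rewrite dotvE !mxE; move: i; apply: ord3P => /=;
  rewrite !(mul0r, mul1r, addr0, add0r).
Qed.

Lemma has_gradD f g x d e : has_grad f x d -> has_grad g x e ->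
  has_grad (fun y => f y + g y) x (d + e).
Proof.
move=> fd ge c t v cx cv.
have F := fd _ _ _ cx cv; have G := ge _ _ _ cx cv.
apply: is_derive_eq; rewrite !dotvE !mxE; ring.
Qed.

Lemma has_gradM f g x d e : has_grad f x d -> has_grad g x e ->
  has_grad (fun y => f y * g y) x (f x *: e + g x *: d).
Proof.
move=> fd ge c t v cx cv.
have F := fd _ _ _ cx cv; have G := ge _ _ _ cx cv.
by apply: is_derive_eq; rewrite !dotvE !mxE /GRing.scale/= cx; ring.
Qed.

Lemma has_grad_comp (h : R -> R) f x d k : is_derive (f x) 1 h k ->
  has_grad f x d -> has_grad (fun y => h (f y)) x (k *: d).
Proof.
move=> hk fd c t v cx cv; rewrite -cx in hk.
have F := fd _ _ _ cx cv.
rewrite (_ : dotv _ _ = k * dotv d v); first exact: (is_derive1_comp hk F).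
rewrite !dotvE !mxE; ring.
Qed.

Lemma has_grad_dotvr a x : has_grad (fun y => dotv y a) x a.
Proof.
move=> c t v cx /is_derive_colP cv; under eq_fun do rewrite dotvE.
by apply: is_derive_eq; rewrite !dotvE /GRing.scale/= !mulr0 !add0r; ring.
Qed.

(* Closed under partial derivatives, and all its members are C^2 and bounded
   on the sphere; [Ga] produces the only integrands below that are not in it. *)
Inductive elementary : ('cV[R]_3 -> R) -> Prop :=
| elementary_cst c : elementary (fun=> c)
| elementary_coord i : elementary (fun x => x i 0)
| elementaryD f g : elementary f -> elementary g ->
    elementary (fun x => f x + g x)
| elementaryM f g : elementary f -> elementary g ->
    elementary (fun x => f x * g x)
| elementary_expR f : elementary f -> elementary (fun x => expR (f x)).

Lemma elementaryN f : elementary f -> elementary (fun x => - f x).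
Proof.
move=> ef; have -> : (fun x => - f x) = (fun x => (-1) * f x).
  by apply/funext => x; rewrite mulN1r.
by apply: elementaryM => //; apply: elementary_cst.
Qed.

Lemma elementary_dotvl a : elementary (fun x => dotv a x).
Proof.
under eq_fun do rewrite dotvE.
by do !apply: elementaryD; apply: elementaryM;
  (apply: elementary_cst || apply: elementary_coord).
Qed.

(** The gradient is built as an explicit family along the induction, so that differentiability and
    membership of its components in the class come out together; only afterwards is it identified
    with [partial i f]. *)
Lemma elementary_grad f : elementary f ->
  exists g : 'I_3 -> 'cV[R]_3 -> R, (forall i, elementary (g i)) /\
    forall x, has_grad f x (\col_i g i x).
Proof.
elim=> {f} [c|i|f g ef [f' [ef' df]] eg [g' [eg' dg]]|
  f g ef [f' [ef' df]] eg [g' [eg' dg]]|f ef [f' [ef' df]]].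
- exists (fun _ _ => 0); split=> [i|x]; first exact: elementary_cst.
  by rewrite (_ : \col_i _ = 0);
    [exact: has_grad_cst|apply/matrixP => i j; rewrite !mxE].
- exists (fun k _ => (delta_mx i 0 : 'cV[R]_3) k 0); split=> [k|x].
    exact: elementary_cst.
  rewrite (_ : \col_k _ = delta_mx i 0); first exact: has_grad_coord.
  by apply/matrixP => k j; rewrite mxE ord1.
- exists (fun i x => f' i x + g' i x); split=> [i|x]; first exact: elementaryD.
  rewrite (_ : \col_i _ = \col_i f' i x + \col_i g' i x); first exact: has_gradD.
  by apply/matrixP => i j; rewrite !mxE.
- exists (fun i x => f x * g' i x + g x * f' i x); split=> [i|x].
    by apply: elementaryD; apply: elementaryM.
  rewrite (_ : \col_i _ = f x *: (\col_i g' i x) + g x *: (\col_i f' i x)).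
    exact: has_gradM.
  by apply/matrixP => i j; rewrite !mxE.
- exists (fun i x => expR (f x) * f' i x); split=> [i|x].
    by apply: elementaryM => //; apply: elementary_expR.
  rewrite (_ : \col_i _ = expR (f x) *: (\col_i f' i x)).
    by apply: has_grad_comp => //; exact: is_derive_expR.
  by apply/matrixP => i j; rewrite !mxE.
Qed.

Lemma elementary_partial f i : elementary f -> elementary (partial i f).
Proof.
move=> /elementary_grad [g [eg fg]].
rewrite (_ : partial i f = g i) //; apply/funext => x.
by have [_] := has_grad_partial i (fg x); rewrite mxE.
Qed.

Lemma elementary_grad_partial f x : elementary f ->
  has_grad f x (\col_i partial i f x).
Proof.
move=> /elementary_grad [g [eg fg]].
rewrite (_ : \col_i _ = \col_i g i x); first exact: fg.
by apply/matrixP => i j; rewrite !mxE; have [_] := has_grad_partial i (fg x);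
  rewrite mxE.
Qed.

Lemma elementary_continuous f : elementary f -> continuous f.
Proof.
elim=> {f} [c|i|f g ef cf eg cg|f g ef cf eg cg|f ef cf] x.
- exact: cst_continuous.
- exact: coord_continuous.
- by apply: (@continuousD _ _ _ f g x); [exact: cf|exact: cg].
- by apply: (@continuousM _ _ f g x); [exact: cf|exact: cg].
- by apply: continuous_comp; [exact: cf|exact: continuous_expR].
Qed.

Lemma elementary_C1 f : elementary f -> C1 f.
Proof.
move=> ef; split=> [i x|i].
  by have [] := has_grad_partial i (@elementary_grad_partial _ x ef).
exact/elementary_continuous/elementary_partial.
Qed.

Lemma elementary_C2 f : elementary f -> C2 f.
Proof.
by move=> ef; split=> [|i]; apply: elementary_C1 => //; exact: elementary_partial.
Qed.

End Elementary.

(** * Integration over the coordinate rectangle *)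

Section ChartIntegral.
Context {R : realType}.
Implicit Types (h k : R * R -> R) (u : R * R).

Local Notation mu := (@lebesgue_measure R).
Local Notation mu2 := (lebesgue_measure \x lebesgue_measure)%E.
Local Notation chart := (@sphere_chart R).

Definition chart_int h : R := \int[mu2]_(u in chart) h u.

(** Boundedness is asked instead of integrability because it survives products; it implies
    integrability since the rectangle has finite measure. *)
Definition chart_regular h : Prop :=
  measurable_fun chart h /\ exists M : R, forall u, chart u -> `|h u| <= M.

Lemma measurable_chart : measurable chart.
Proof. by apply: measurableX; exact: measurable_itv. Qed.

Lemma chart_finite : (mu2 chart < +oo)%E.
Proof.
rewrite /sphere_chart product_measure1E; [|exact: measurable_itv..].
by rewrite /= !lebesgue_measure_itv/= !lte_fin pi_gt0 mulr_gt0 ?pi_gt0// -!EFinD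
  -EFinM ltry.
Qed.

Lemma chart_regular_integrable h : chart_regular h ->
  mu2.-integrable chart (EFin \o h).
Proof.
move=> [mh [M hM]]; apply: measurable_bounded_integrable => //.
- exact: measurable_chart.
- exact: chart_finite.
exists M; split; first exact: num_real.
by move=> x Mx u /hM /le_trans; apply; exact: ltW.
Qed.

Lemma chart_regularD h k : chart_regular h -> chart_regular k ->
  chart_regular (fun u => h u + k u).
Proof.
move=> [mh [M hM]] [mk [N kN]]; split; first exact: measurable_funD.
exists (M + N) => u cu; rewrite (le_trans (ler_normD _ _))// lerD ?hM ?kN//.
Qed.

Lemma chart_regularM h k : chart_regular h -> chart_regular k ->
  chart_regular (fun u => h u * k u).
Proof.
move=> [mh [M hM]] [mk [N kN]]; split; first exact: measurable_funM.
by exists (M * N) => u cu; rewrite normrM ler_pM ?hM ?kN.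
Qed.

Lemma chart_regular_cst c : chart_regular (fun=> c).
Proof. by split; [exact: measurable_cst|exists `|c|]. Qed.

Lemma chart_regular_expR h : chart_regular h ->
  chart_regular (fun u => expR (h u)).
Proof.
move=> [mh [M hM]]; split.
  by apply: (measurableT_comp _ mh); exact: measurable_expR.
exists (expR M) => u /hM; rewrite ler_norml ger0_norm ?expR_ge0// ler_expR.
by case/andP.
Qed.

Lemma continuous_measurable_fst (f : R -> R) (D : set (R * R)) : continuous f ->
  measurable_fun D (fun u : R * R => f u.1).
Proof.
move=> cf; apply: measurable_funTS.
apply: (measurableT_comp (f := f)); last exact: measurable_fst.
exact: continuous_measurable_fun.
Qed.

Lemma continuous_measurable_snd (f : R -> R) (D : set (R * R)) : continuous f ->
  measurable_fun D (fun u : R * R => f u.2).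
Proof.
move=> cf; apply: measurable_funTS.
apply: (measurableT_comp (f := f)); last exact: measurable_snd.
exact: continuous_measurable_fun.
Qed.

Lemma chart_regular_sin1 : chart_regular (fun u => sin u.1).
Proof.
split; first exact: (continuous_measurable_fst (@continuous_sin R)).
by exists 1 => u _; rewrite ler_norml sin_geN1 sin_le1.
Qed.

Lemma chart_regular_cos1 : chart_regular (fun u => cos u.1).
Proof.
split; first exact: (continuous_measurable_fst (@continuous_cos R)).
by exists 1 => u _; rewrite ler_norml cos_geN1 cos_le1.
Qed.

Lemma chart_regular_sin2 : chart_regular (fun u => sin u.2).
Proof.
split; first exact: (continuous_measurable_snd (@continuous_sin R)).
by exists 1 => u _; rewrite ler_norml sin_geN1 sin_le1.
Qed.

Lemma chart_regular_cos2 : chart_regular (fun u => cos u.2).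
Proof.
split; first exact: (continuous_measurable_snd (@continuous_cos R)).
by exists 1 => u _; rewrite ler_norml cos_geN1 cos_le1.
Qed.

Lemma chart_intD h k : chart_regular h -> chart_regular k ->
  chart_int (fun u => h u + k u) = chart_int h + chart_int k.
Proof.
move=> rh rk; rewrite /chart_int RintegralD//; first exact: measurable_chart.
- exact: chart_regular_integrable.
- exact: chart_regular_integrable.
Qed.

Lemma derive_integral (f F : R -> R) (a b : R) : a < b ->
  (forall x : R, is_derive x 1 F (f x)) -> continuous f ->
  (\int[mu]_(x in `[a, b]) (f x)%:E = (F b - F a)%:E)%E.
Proof.
move=> ab dF cf.
have cF : continuous F.
  move=> x; apply/differentiable_continuous/derivable1_diffP.
  by have [] := dF x.
rewrite (@continuous_FTC2 _ f F a b ab) ?EFinB//.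
- exact: continuous_subspaceT.
- split; first by move=> x _; have [] := dF x.
  + exact/cvg_at_right_filter/cF.
  + exact/cvg_at_left_filter/cF.
- by move=> x _; rewrite derive1E; have [_ ->] := dF x.
Qed.

(** Fubini, with the inner integral supplied in closed form as [F]. All integrands are extended by
    zero to the whole plane or line, and the case splits compare the extension from the rectangle
    with those from its two sides. *)
Lemma chart_int_fst h (F : R -> R) : chart_regular h ->
  (forall x : R, x \in `[0, pi] ->
    (\int[mu]_(y in `[0%R, (2 * pi)%R]) (h (x, y))%:E = (F x)%:E)%E) ->
  (chart_int h)%:E = (\int[mu]_(x in `[0%R, pi]) (F x)%:E)%E.
Proof.
move=> rh hF; have ih := chart_regular_integrable rh.
rewrite /chart_int /Rintegral fineK; last by apply: integrable_fin_num ih;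
  exact: measurable_chart.
rewrite integral_mkcond -integral12_prod_meas1; last first.
  by rewrite -integrable_mkcond//; exact: measurable_chart.
rewrite [RHS]integral_mkcond; apply: eq_integral => x _.
rewrite /fubini_F [RHS]patchE; case: ifPn => x0.
  rewrite -hF; last by rewrite inE in x0.
  rewrite [RHS]integral_mkcond; apply: eq_integral => y _.
  rewrite !patchE; case: ifPn => [|].
    by rewrite inE => -[_ /= y0]; rewrite mem_set.
  case: ifPn => // y0 /negP[]; rewrite !inE in x0 y0 *; by split.
rewrite integral0_eq// => y _; rewrite patchE; case: ifPn => //.
by rewrite inE => -[/= xx _]; rewrite mem_set in x0.
Qed.

Lemma chart_int_snd h (F : R -> R) : chart_regular h ->
  (forall y : R, y \in `[0, (2 * pi)] ->
    (\int[mu]_(x in `[0%R, pi]) (h (x, y))%:E = (F y)%:E)%E) ->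
  (chart_int h)%:E = (\int[mu]_(y in `[0%R, (2 * pi)%R]) (F y)%:E)%E.
Proof.
move=> rh hF; have ih := chart_regular_integrable rh.
rewrite /chart_int /Rintegral fineK; last by apply: integrable_fin_num ih;
  exact: measurable_chart.
rewrite integral_mkcond -integral21_prod_meas1; last first.
  by rewrite -integrable_mkcond//; exact: measurable_chart.
rewrite [RHS]integral_mkcond; apply: eq_integral => y _.
rewrite /fubini_G [RHS]patchE; case: ifPn => y0.
  rewrite -hF; last by rewrite inE in y0.
  rewrite [RHS]integral_mkcond; apply: eq_integral => x _.
  rewrite !patchE; case: ifPn => [|].
    by rewrite inE => -[/= x0 _]; rewrite mem_set.
  case: ifPn => // x0 /negP[]; rewrite !inE in x0 y0 *; by split.
rewrite integral0_eq// => x _; rewrite patchE; case: ifPn => //.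
by rewrite inE => -[_ /= yy]; rewrite mem_set in y0.
Qed.

Lemma pi2_gt0 : 0 < 2 * pi :> R.
Proof. by rewrite mulr_gt0 ?pi_gt0. Qed.

Lemma chart_int_derive_snd h k : chart_regular h ->
  (forall x y : R, is_derive y 1 (fun y => k (x, y)) (h (x, y))) ->
  (forall x, continuous (fun y => h (x, y))) ->
  (forall x, k (x, 2 * pi) = k (x, 0)) -> chart_int h = 0.
Proof.
move=> rh dk ch k0; apply: EFin_inj; rewrite (chart_int_fst (F := fun=> 0) rh).
  by rewrite integral0.
by move=> x _; rewrite (derive_integral pi2_gt0 (dk x) (ch x)) k0 subrr.
Qed.

Lemma chart_int_derive_fst h k : chart_regular h ->
  (forall x y : R, is_derive x 1 (fun x => k (x, y)) (h (x, y))) ->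
  (forall y, continuous (fun x => h (x, y))) ->
  (forall y, k (pi, y) = k (0, y)) -> chart_int h = 0.
Proof.
move=> rh dk ch k0; apply: EFin_inj; rewrite (chart_int_snd (F := fun=> 0) rh).
  by rewrite integral0.
move=> y _.
by rewrite (derive_integral (pi_gt0 R) (fun x => dk x y) (ch y)) k0 subrr.
Qed.

Lemma chart_int_sin : chart_int (fun u => sin u.1) = 4 * pi.
Proof.
have dcos (x : R) : is_derive x 1 (fun x => - cos x) (sin x).
  by apply: is_derive_eq; rewrite opprK.
apply: EFin_inj; rewrite (chart_int_snd (F := fun=> 2) chart_regular_sin1).
  rewrite integral_cst//= lebesgue_measure_itv/= lte_fin pi2_gt0 -EFinD -EFinM.
  by congr EFin; ring.
move=> y _ /=; rewrite (derive_integral (pi_gt0 R) dcos); last exact: continuous_sin.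
by rewrite cospi cos0; congr EFin; ring.
Qed.

End ChartIntegral.

(** * Surface integrals in spherical coordinates *)

Section SphereIntegral.
Context {R : realType}.
Implicit Types (f g : 'cV[R]_3 -> R) (u : R * R).

Local Notation mu2 := (lebesgue_measure \x lebesgue_measure)%E.
Local Notation chart := (@sphere_chart R).

Lemma sphere_ptE u : [/\ sphere_pt u 0 0 = sin u.1 * cos u.2,
  sphere_pt u 1 0 = sin u.1 * sin u.2 & sphere_pt u 2 0 = cos u.1].
Proof. by rewrite !mxE. Qed.

Lemma dotv_sphere_pt u : dotv (sphere_pt u) (sphere_pt u) = 1.
Proof.
rewrite dotvE; have [-> -> ->] := sphere_ptE u.
transitivity (sin u.1 ^+ 2 * (cos u.2 ^+ 2 + sin u.2 ^+ 2) + cos u.1 ^+ 2); first ring.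
by rewrite cos2Dsin2 mulr1 addrC cos2Dsin2.
Qed.

Lemma sphere_pt_sphere u : sphere (sphere_pt u).
Proof. by rewrite /sphere/= /enorm dotv_sphere_pt sqrtr1. Qed.

Lemma elementary_chart_regular f : elementary f ->
  chart_regular (fun u => f (sphere_pt u)).
Proof.
elim=> {f} [c|i|f g _ rf _ rg|f g _ rf _ rg|f _ rf].
- exact: chart_regular_cst.
- move: i; apply: ord3P.
  + rewrite (_ : (fun u => _) = (fun u : R * R => sin u.1 * cos u.2)).
      by apply: chart_regularM; [exact: chart_regular_sin1|exact: chart_regular_cos2].
    by apply/funext => u; have [] := sphere_ptE u.
  + rewrite (_ : (fun u => _) = (fun u : R * R => sin u.1 * sin u.2)).
      by apply: chart_regularM; [exact: chart_regular_sin1|exact: chart_regular_sin2].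
    by apply/funext => u; have [] := sphere_ptE u.
  + rewrite (_ : (fun u => _) = (fun u : R * R => cos u.1)).
      exact: chart_regular_cos1.
    by apply/funext => u; have [] := sphere_ptE u.
- exact: chart_regularD.
- exact: chart_regularM.
- exact: chart_regular_expR.
Qed.

Definition sphere_integrable f : Prop :=
  mu2.-integrable chart (fun u => (f (sphere_pt u) * sin u.1)%:E).

Lemma elementary_sphere_integrable f : elementary f -> sphere_integrable f.
Proof.
move=> ef; apply: chart_regular_integrable; apply: chart_regularM.
  exact: elementary_chart_regular.
exact: chart_regular_sin1.
Qed.

Lemma eq_sphere_int f g : (forall x, sphere x -> f x = g x) ->
  sphere_int f = sphere_int g.
Proof.
move=> fg; apply: eq_Rintegral => u _; rewrite fg//; exact: sphere_pt_sphere.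
Qed.

Lemma sphere_intD f g : sphere_integrable f -> sphere_integrable g ->
  sphere_int (fun x => f x + g x) = sphere_int f + sphere_int g.
Proof.
move=> rf rg; rewrite /sphere_int -RintegralD//; last exact: measurable_chart.
by under eq_Rintegral do rewrite mulrDl.
Qed.

Lemma sphere_intZ c f : sphere_integrable f ->
  sphere_int (fun x => c * f x) = c * sphere_int f.
Proof.
move=> rf; rewrite /sphere_int -RintegralZl//; last exact: measurable_chart.
by under eq_Rintegral do rewrite -mulrA.
Qed.

Lemma sphere_intB f g : sphere_integrable f -> sphere_integrable g ->
  sphere_int (fun x => f x - g x) = sphere_int f - sphere_int g.
Proof.
move=> rf rg; rewrite /sphere_int -RintegralB//; last exact: measurable_chart.
by under eq_Rintegral do rewrite mulrBl.
Qed.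

Lemma sphere_int1 : sphere_int (fun=> 1 : R) = 4 * pi.
Proof.
by rewrite -chart_int_sin; apply: eq_Rintegral => u _; rewrite mul1r.
Qed.

Lemma is_derive_sphere_pt1 (x y : R) : is_derive x 1 (fun x => sphere_pt (x, y))
  (\col_i [:: cos x * cos y; cos x * sin y; - sin x]`_i).
Proof.
apply/is_derive_colP; apply: ord3P; rewrite mxE/=.
- rewrite (_ : (fun s => _) = (fun s => sin s * cos y)).
    by apply: is_derive_eq; rewrite /GRing.scale/=; ring.
  by apply/funext => s; have [] := sphere_ptE (s, y).
- rewrite (_ : (fun s => _) = (fun s => sin s * sin y)).
    by apply: is_derive_eq; rewrite /GRing.scale/=; ring.
  by apply/funext => s; have [] := sphere_ptE (s, y).
- rewrite (_ : (fun s => _) = cos); first exact: is_derive_cos.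
  by apply/funext => s; have [] := sphere_ptE (s, y).
Qed.

Lemma is_derive_sphere_pt2 (x y : R) : is_derive y 1 (fun y => sphere_pt (x, y))
  (\col_i [:: - (sin x * sin y); sin x * cos y; 0]`_i).
Proof.
apply/is_derive_colP; apply: ord3P; rewrite mxE/=.
- rewrite (_ : (fun s => _) = (fun s => sin x * cos s)).
    by apply: is_derive_eq; rewrite /GRing.scale/=; ring.
  by apply/funext => s; have [] := sphere_ptE (x, s).
- rewrite (_ : (fun s => _) = (fun s => sin x * sin s)).
    by apply: is_derive_eq; rewrite /GRing.scale/=; ring.
  by apply/funext => s; have [] := sphere_ptE (x, s).
- rewrite (_ : (fun s => _) = (fun=> cos x)).
    by apply: is_derive_eq.
  by apply/funext => s; have [] := sphere_ptE (x, s).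
Qed.

End SphereIntegral.

(** * Rotation fields integrate to zero *)

Section Rotations.
Context {R : realType}.
Implicit Types (f g : 'cV[R]_3 -> R) (u : R * R).

(** The derivative of f in the polar angle, expanded by the chain rule into ambient partial
    derivatives. *)
Definition polar_derive f u := partial 0 f (sphere_pt u) * (cos u.1 * cos u.2) +
  partial 1 f (sphere_pt u) * (cos u.1 * sin u.2) -
  partial 2 f (sphere_pt u) * sin u.1.

(** The derivative in the azimuth, which is also the rotation field x_0 d_1 - x_1 d_0 about the z
    axis. *)
Definition azimuth_derive f u := partial 1 f (sphere_pt u) * (sin u.1 * cos u.2) -
  partial 0 f (sphere_pt u) * (sin u.1 * sin u.2).

Lemma is_derive_polar f (x y : R) : elementary f ->
  is_derive x 1 (fun x => f (sphere_pt (x, y))) (polar_derive f (x, y)).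
Proof.
move=> ef; have df := @elementary_grad_partial _ _ (sphere_pt (x, y)) ef.
rewrite (_ : polar_derive f _ = dotv (\col_i partial i f (sphere_pt (x, y)))
  (\col_i [:: cos x * cos y; cos x * sin y; - sin x]`_i)).
  exact: (df (fun x => sphere_pt (x, y)) x _ erefl (is_derive_sphere_pt1 x y)).
rewrite dotvE !mxE /polar_derive/=.
move: (sin x) (cos x) (sin y) (cos y) (partial 0 f _) (partial 1 f _)
  (partial 2 f _) => *; ring.
Qed.

Lemma is_derive_azimuth f (x y : R) : elementary f ->
  is_derive y 1 (fun y => f (sphere_pt (x, y))) (azimuth_derive f (x, y)).
Proof.
move=> ef; have df := @elementary_grad_partial _ _ (sphere_pt (x, y)) ef.
rewrite (_ : azimuth_derive f _ = dotv (\col_i partial i f (sphere_pt (x, y)))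
  (\col_i [:: - (sin x * sin y); sin x * cos y; 0]`_i)).
  exact: (df (fun y => sphere_pt (x, y)) y _ erefl (is_derive_sphere_pt2 x y)).
rewrite dotvE !mxE /azimuth_derive/=.
move: (sin x) (cos x) (sin y) (cos y) (partial 0 f _) (partial 1 f _)
  (partial 2 f _) => *; ring.
Qed.

Lemma polar_derive_regular f : elementary f -> chart_regular (polar_derive f).
Proof.
move=> ef; have rp i := elementary_chart_regular (elementary_partial i ef).
have [s1 c1 s2 c2] := And4 (@chart_regular_sin1 R) (@chart_regular_cos1 R)
  (@chart_regular_sin2 R) (@chart_regular_cos2 R).
rewrite (_ : polar_derive f = fun u => partial 0 f (sphere_pt u) * (cos u.1 * cos u.2) +
  partial 1 f (sphere_pt u) * (cos u.1 * sin u.2) +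
  -1 * (partial 2 f (sphere_pt u) * sin u.1)); last first.
  by apply/funext => u; rewrite mulN1r.
apply: chart_regularD; first apply: chart_regularD.
- by apply: chart_regularM => //; exact: chart_regularM.
- by apply: chart_regularM => //; exact: chart_regularM.
- by apply: chart_regularM; [exact: chart_regular_cst|exact: chart_regularM].
Qed.

Lemma azimuth_derive_regular f : elementary f -> chart_regular (azimuth_derive f).
Proof.
move=> ef; have rp i := elementary_chart_regular (elementary_partial i ef).
have [s1 c1 s2 c2] := And4 (@chart_regular_sin1 R) (@chart_regular_cos1 R)
  (@chart_regular_sin2 R) (@chart_regular_cos2 R).
rewrite (_ : azimuth_derive f = fun u => partial 1 f (sphere_pt u) *
  (sin u.1 * cos u.2) +
  -1 * (partial 0 f (sphere_pt u) * (sin u.1 * sin u.2))); last first.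
  by apply/funext => u; rewrite mulN1r.
apply: chart_regularD.
- by apply: chart_regularM => //; exact: chart_regularM.
- apply: chart_regularM; first exact: chart_regular_cst.
  by apply: chart_regularM => //; exact: chart_regularM.
Qed.

Lemma derivable_continuous (f : R -> R) :
  (forall x : R, derivable f x 1) -> continuous f.
Proof. by move=> df x; apply/differentiable_continuous/derivable1_diffP. Qed.

(** The integrand is the polar derivative of b(u.2) sin(u.1) f, and sin vanishes at both poles, so
    there is no boundary term. *)
Lemma chart_int_polar f (b b' : R -> R) : elementary f ->
  chart_regular (fun u => b u.2) ->
  (forall y : R, is_derive y 1 b (b' y)) ->
  chart_int (fun u =>
    b u.2 * (cos u.1 * f (sphere_pt u) + sin u.1 * polar_derive f u)) = 0.
Proof.
move=> ef rb db; have ep i := elementary_partial i ef.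
apply: (@chart_int_derive_fst _ _ (fun u => b u.2 * (sin u.1 * f (sphere_pt u)))).
- apply: chart_regularM => //; apply: chart_regularD; apply: chart_regularM.
  + exact: chart_regular_cos1.
  + exact: elementary_chart_regular.
  + exact: chart_regular_sin1.
  + exact: polar_derive_regular.
- move=> x y /=; have D := is_derive_polar x y ef.
  apply: is_derive_eq; rewrite /GRing.scale/=; ring.
- move=> y; have D x := is_derive_polar x y ef.
  have E i x := is_derive_polar x y (ep i).
  (* Continuity of the integrand comes from differentiating once more, which [E] allows because the
     partial derivatives of f are again elementary. *)
  apply: derivable_continuous => x /=; rewrite /polar_derive/=; exact: ex_derive.
- by move=> y /=; rewrite sinpi sin0 !mul0r !mulr0.
Qed.

(** Here the boundary terms cancel by periodicity: both b and [sphere_pt] take the same values at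
    azimuth 0 and 2 pi. *)
Lemma chart_int_azimuth f (a a' b b' b'' : R -> R) : elementary f ->
  chart_regular (fun u => a u.1) ->
  chart_regular (fun u => b u.2) -> chart_regular (fun u => b' u.2) ->
  (forall x : R, is_derive x 1 a (a' x)) ->
  (forall y : R, is_derive y 1 b (b' y)) -> (forall y : R, is_derive y 1 b' (b'' y)) ->
  b (2 * pi) = b 0 ->
  chart_int (fun u =>
    a u.1 * (b' u.2 * f (sphere_pt u) + b u.2 * azimuth_derive f u)) = 0.
Proof.
move=> ef ra rb rb' da db db' bp; have ep i := elementary_partial i ef.
apply: (@chart_int_derive_snd _ _ (fun u => a u.1 * (b u.2 * f (sphere_pt u)))).
- apply: chart_regularM => //; apply: chart_regularD; apply: chart_regularM => //.
  + exact: elementary_chart_regular.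
  + exact: azimuth_derive_regular.
- move=> x y /=; have D := is_derive_azimuth x y ef.
  apply: is_derive_eq; rewrite /GRing.scale/=; ring.
- move=> x; have D y := is_derive_azimuth x y ef.
  have E i y := is_derive_azimuth x y (ep i).
  apply: derivable_continuous => y /=; rewrite /azimuth_derive/=; exact: ex_derive.
- move=> x /=; rewrite bp; congr (_ * (_ * f _)).
  apply/colP; apply: ord3P; rewrite !mxE/=.
  + by rewrite mulr_natl cos2pi cos0.
  + by rewrite mulr_natl sin2pi sin0.
  + by [].
Qed.

Lemma chart_regularN (h : R * R -> R) : chart_regular h ->
  chart_regular (fun u => - h u).
Proof.
move=> rh; under eq_fun do rewrite -mulN1r.
by apply: chart_regularM => //; exact: chart_regular_cst.
Qed.

Lemma sphere_int_rotation_z f : elementary f ->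
  sphere_int (fun x => x 0 0 * partial 1 f x - x 1 0 * partial 0 f x) = 0.
Proof.
move=> ef.
rewrite -(@chart_int_azimuth f sin cos (fun=> 1) (fun=> 0) (fun=> 0) ef)//.
- apply: eq_Rintegral => u _; have [-> -> _] := sphere_ptE u.
  rewrite /azimuth_derive.
  move: (sin u.1) (sin u.2) (cos u.2) (f _) (partial 0 f _) (partial 1 f _) => *.
  ring.
- exact: chart_regular_sin1.
- exact: chart_regular_cst.
- exact: chart_regular_cst.
Qed.

(* [sin u.1] times the rotation field about the x axis is minus
   [d/du.1 (sin u.2 sin u.1 f) + d/du.2 (cos u.1 cos u.2 f)]; a quarter turn of
   the azimuth gives the y axis. *)
Lemma sphere_int_rotation_xy f (b b' b'' : R -> R) : elementary f ->
  chart_regular (fun u => b u.2) -> chart_regular (fun u => b' u.2) ->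
  (forall y : R, is_derive y 1 b (b' y)) ->
  (forall y : R, is_derive y 1 b' (b'' y)) ->
  (forall y, b'' y = - b y) -> b' (2 * pi) = b' 0 ->
  chart_int (fun u => b u.2 * (cos u.1 * f (sphere_pt u) + sin u.1 * polar_derive f u)
    + cos u.1 * (b'' u.2 * f (sphere_pt u) + b' u.2 * azimuth_derive f u)) = 0.
Proof.
move=> ef rb rb' db db' bE bp.
have rb'' : chart_regular (fun u => b'' u.2).
  by under eq_fun do rewrite bE; exact: chart_regularN.
have rf := elementary_chart_regular ef.
have rc := @chart_regular_cos1 R.
rewrite chart_intD.
- rewrite (chart_int_polar ef rb db) add0r.
  apply: (@chart_int_azimuth f cos (fun x => - sin x) b' b'' (fun y => - b' y)) => // y.
  rewrite (_ : b'' = fun y => - b y); last exact/funext.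
  exact: is_deriveN.
- apply: chart_regularM => //; apply: chart_regularD; apply: chart_regularM => //.
    exact: chart_regular_sin1.
  exact: polar_derive_regular.
- apply: chart_regularM => //; apply: chart_regularD; apply: chart_regularM => //.
  exact: azimuth_derive_regular.
Qed.

Lemma sphere_int_rotation_x f : elementary f ->
  sphere_int (fun x => x 2 0 * partial 1 f x - x 1 0 * partial 2 f x) = 0.
Proof.
move=> ef.
rewrite -(@sphere_int_rotation_xy f sin cos (fun x => - sin x) ef).
- apply: eq_Rintegral => u _; have [_ -> ->] := sphere_ptE u.
  rewrite /azimuth_derive /polar_derive.
  have := cos2Dsin2 u.2.
  move: (sin u.1) (cos u.1) (sin u.2) (cos u.2) (f _) (partial 0 f _)
    (partial 1 f _) (partial 2 f _).
  move=> s c s' c' F p0 p1 p2 sc.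
  (* The terms in f and [partial 0 f] cancel identically; the coefficient of [partial 1 f] alone
     needs cos^2 + sin^2 = 1 in the azimuth. *)
  rewrite -[c * p1]mulr1 -sc; ring.
- exact: chart_regular_sin2.
- exact: chart_regular_cos2.
- by [].
- by rewrite mulr_natl cos2pi cos0.
Qed.

Lemma sphere_int_rotation_y f : elementary f ->
  sphere_int (fun x => x 2 0 * partial 0 f x - x 0 0 * partial 2 f x) = 0.
Proof.
move=> ef.
rewrite -(@sphere_int_rotation_xy f cos (fun x => - sin x) (fun x => - cos x) ef).
- apply: eq_Rintegral => u _; have [-> _ ->] := sphere_ptE u.
  rewrite /azimuth_derive /polar_derive.
  have := cos2Dsin2 u.2.
  move: (sin u.1) (cos u.1) (sin u.2) (cos u.2) (f _) (partial 0 f _)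
    (partial 1 f _) (partial 2 f _).
  move=> s c s' c' F p0 p1 p2 sc.
  rewrite -[c * p0]mulr1 -sc; ring.
- exact: chart_regular_cos2.
- by apply: chart_regularN; exact: chart_regular_sin2.
- by [].
- by rewrite mulr_natl sin2pi sin0.
Qed.

End Rotations.

(** * Unnormalized moments of exp(theta.x) *)

Section Moments.
Context {R : realType}.
Implicit Types (f g q l : 'cV[R]_3 -> R) (x th : 'cV[R]_3).

Local Notation mu2 := (lebesgue_measure \x lebesgue_measure)%E.
Local Notation chart := (@sphere_chart R).

(** Index form of the three axis identities, the diagonal being trivial. It lets the moment
    relations be stated for all indices at once. *)
Lemma sphere_int_rotation f a b : elementary f ->
  sphere_int (fun x => x a 0 * partial b f x) =
  sphere_int (fun x => x b 0 * partial a f x).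
Proof.
move=> ef.
have i c d : sphere_integrable (fun x => x c 0 * partial d f x).
  apply/elementary_sphere_integrable/elementaryM; first exact: elementary_coord.
  exact: elementary_partial.
have rot c d : sphere_int (fun x => x c 0 * partial d f x - x d 0 * partial c f x)
  = 0 ->
    sphere_int (fun x => x c 0 * partial d f x) =
    sphere_int (fun x => x d 0 * partial c f x).
  by rewrite sphere_intB; [exact: subr0_eq|exact: i..].
have sym (S : 'I_3 -> 'I_3 -> R) : S 2 1 = S 1 2 -> S 2 0 = S 0 2 ->
    S 0 1 = S 1 0 -> S a b = S b a.
  by move=> S21 S20 S01; move: a b; apply: ord3P; apply: ord3P.
apply: (sym (fun c d => sphere_int (fun x => x c 0 * partial d f x))).
- exact: rot (sphere_int_rotation_x ef).
- exact: rot (sphere_int_rotation_y ef).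
- exact: rot (sphere_int_rotation_z ef).
Qed.

(** The factor exp(-kappa) is left out of these moments, because that it normalizes the density is
    one of their consequences. *)
Definition moment0 th : R := sphere_int (fun x => expR (dotv th x)).
Definition moment1 th i : R := sphere_int (fun x => x i 0 * expR (dotv th x)).
Definition moment2 th i j : R :=
  sphere_int (fun x => x i 0 * (x j 0 * expR (dotv th x))).

Lemma elementary_exp_dotv th : elementary (fun x => expR (dotv th x)).
Proof. exact/elementary_expR/elementary_dotvl. Qed.

Lemma elementary_moment1 th i : elementary (fun x => x i 0 * expR (dotv th x)).
Proof. apply: elementaryM; [exact: elementary_coord|exact: elementary_exp_dotv]. Qed.

Lemma elementary_moment2 th i j :
  elementary (fun x => x i 0 * (x j 0 * expR (dotv th x))).
Proof. apply: elementaryM; [exact: elementary_coord|exact: elementary_moment1]. Qed.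

Lemma dotvC x y : dotv x y = dotv y x :> R.
Proof. rewrite !dotvE; ring. Qed.

Lemma partialE f x d i : has_grad f x d -> partial i f x = d i 0.
Proof. by move=> /(has_grad_partial i)[_]. Qed.

Lemma has_grad_exp_dotv th x :
  has_grad (fun y => expR (dotv th y)) x (expR (dotv th x) *: th).
Proof.
have -> : (fun y => expR (dotv th y)) = (fun y => expR (dotv y th)).
  by apply/funext => y; rewrite dotvC.
rewrite [dotv th x]dotvC.
exact: (has_grad_comp (is_derive_expR _) (@has_grad_dotvr _ th x)).
Qed.

(** Rotation invariance applied to exp(theta.x): the cross product of the first moment with theta
    vanishes. *)
Lemma moment1_parallel th a b : moment1 th a * th b 0 = moment1 th b * th a 0.
Proof.
have rot := sphere_int_rotation a b (elementary_exp_dotv th).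
have E c d : sphere_int (fun x => x c 0 * partial d (fun y => expR (dotv th y)) x) =
    moment1 th c * th d 0.
  rewrite mulrC -sphere_intZ;
    last exact/elementary_sphere_integrable/elementary_moment1.
  apply: eq_sphere_int => x _; rewrite (partialE _ (@has_grad_exp_dotv _ _)) !mxE; ring.
exact: etrans (esym (E a b)) (etrans rot (E b a)).
Qed.

Lemma moment2_rotation th k a b :
  moment2 th k a * th b 0 + (k == b)%:R * moment1 th a =
  moment2 th k b * th a 0 + (k == a)%:R * moment1 th b.
Proof.
have rot := sphere_int_rotation a b (elementary_moment1 th k).
have E c d : sphere_int
  (fun x => x c 0 * partial d (fun y => y k 0 * expR (dotv th y)) x) =
    moment2 th k c * th d 0 + (k == d)%:R * moment1 th c.
  rewrite [X in X + _]mulrC -!sphere_intZ; last 2 first.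
  - exact/elementary_sphere_integrable/elementary_moment1.
  - exact/elementary_sphere_integrable/elementary_moment2.
  rewrite -sphere_intD; last 2 first.
  - apply/elementary_sphere_integrable/elementaryM; first exact: elementary_cst.
    exact: elementary_moment2.
  - apply/elementary_sphere_integrable/elementaryM; first exact: elementary_cst.
    exact: elementary_moment1.
  apply: eq_sphere_int => x _.
  rewrite (partialE _ (has_gradM (@has_grad_coord _ k x) (@has_grad_exp_dotv th x))).
  by rewrite !mxE eqxx andbT eq_sym; ring.
exact: etrans (esym (E a b)) (etrans rot (E b a)).
Qed.

Lemma moment2C th i j : moment2 th i j = moment2 th j i.
Proof. by apply: eq_sphere_int => x _; ring. Qed.

Lemma moment2_trace th :
  moment2 th 0 0 + moment2 th 1 1 + moment2 th 2 2 = moment0 th.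
Proof.
have i a b := elementary_sphere_integrable (elementary_moment2 th a b).
rewrite /moment2 -sphere_intD// -sphere_intD//; last first.
  by apply: elementary_sphere_integrable; apply: elementaryD; exact: elementary_moment2.
apply: eq_sphere_int => x /sphere_dotv; rewrite dotvE => xx.
by rewrite !mulrA -!mulrDl xx mul1r.
Qed.

(** Sum [moment2_rotation th c k c] over c. The Kronecker terms give three copies of the first
    moment on one side and one on the other, whence the factor 2; the remaining sum is the trace,
    which is [moment0] because |x| = 1. *)
Lemma moment2_mul th k : moment2 th k 0 * th 0 0 + moment2 th k 1 * th 1 0 +
  moment2 th k 2 * th 2 0 = moment0 th * th k 0 - 2 * moment1 th k.
Proof.
rewrite -moment2_trace.
have := moment2_rotation th 0 k 0; have := moment2_rotation th 1 k 1.
have := moment2_rotation th 2 k 2; rewrite !eqxx.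
rewrite ![moment2 th _ k]moment2C.
move: (moment2 th) (moment1 th) => M m; move: k; apply: ord3P => /=; lra.
Qed.

Lemma elementary_mul_exp q l (s : R) : elementary q -> elementary l ->
  elementary (fun x => q x * expR (s * l x)).
Proof.
move=> eq el; apply: elementaryM => //; apply: elementary_expR.
by apply: elementaryM => //; exact: elementary_cst.
Qed.

Lemma is_derive_sphere_int q l (s : R) : elementary q -> elementary l ->
  is_derive s 1 (fun s => sphere_int (fun x => q x * expR (s * l x)))
    (sphere_int (fun x => q x * (l x * expR (s * l x)))).
Proof.
move=> eq el.
pose F (s : R) (u : R * R) := q (sphere_pt u) * expR (s * l (sphere_pt u)) * sin u.1.
have dF (y : R) u : is_derive y 1 (fun s => F s u)
    (q (sphere_pt u) * (l (sphere_pt u) * expR (y * l (sphere_pt u))) * sin u.1).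
  have D : is_derive y 1 (fun s => expR (s * l (sphere_pt u))) 
      (expR (y * l (sphere_pt u)) * l (sphere_pt u)).
    apply: is_derive1_comp; apply: is_derive_eq; rewrite /GRing.scale/=; ring.
  rewrite /F; apply: is_derive_eq; rewrite /GRing.scale/=; ring.
have [_ [Mq hq]] := elementary_chart_regular eq.
have [_ [Ml hl]] := elementary_chart_regular el.
have iF (y : R) : mu2.-integrable chart (EFin \o F y).
  exact: (elementary_sphere_integrable (elementary_mul_exp y eq el)).
(* A bound on the derivative of the integrand, uniform for parameters within distance 1 of s: Mq and
   Ml bound q and l on the sphere, and |sin| is at most 1. *)
pose K := Mq * (Ml * expR ((`|s| + 1) * Ml)).
have pE y u : partial1of2 F y u =
    q (sphere_pt u) * (l (sphere_pt u) * expR (y * l (sphere_pt u))) * sin u.1.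
  by rewrite partial1of2E; have [] := dF y u.
have ss : `]s - 1, s + 1[%classic s by rewrite /= in_itv/=; apply/andP; split; lra.
have bF y u : `]s - 1, s + 1[%classic y -> chart u -> `|partial1of2 F y u| <= K.
  rewrite /= in_itv/= => ys cu; rewrite pE !normrM.
  have sin1 : `|sin u.1| <= 1 by rewrite ler_norml sin_geN1 sin_le1.
  have ly : expR (y * l (sphere_pt u)) <= expR ((`|s| + 1) * Ml).
    rewrite ler_expR (le_trans (ler_norm _))// normrM ler_pM ?hl//.
    rewrite (_ : y = s + (y - s)); last ring.
    rewrite (le_trans (ler_normD _ _))// lerD2l ler_norml; apply/andP; split; lra.
  rewrite -[K]mulr1 ler_pM ?mulr_ge0// ler_pM ?mulr_ge0//; first exact: hq.
  rewrite ler_pM//; first exact: hl.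
  by rewrite ger0_norm ?expR_ge0.
have iK : mu2.-integrable chart (EFin \o (fun=> `|K|)).
  exact: (chart_regular_integrable (chart_regular_cst _)).
have bF' y u : `]s - 1, s + 1[%classic y -> chart u -> `|partial1of2 F y u| <= `|K|.
  by move=> ys cu; rewrite (le_trans (bF _ _ ys cu)) ?ler_norm.
have dF1 y u : `]s - 1, s + 1[%classic y -> chart u -> derivable (F^~ u) y 1.
  by move=> _ _; have [] := dF y u.
split.
  apply: (@derivable_under_integral _ _ _ mu2 F chart _ _ _ _ ss (fun y _ => iF y)
    dF1 _ (fun=> normr_ge0 K) iK bF').
  exact: measurable_chart.
rewrite -derive1E.
transitivity (\int[mu2]_(u in chart) partial1of2 F s u).
  apply: (@differentiation_under_integral _ _ _ mu2 F chart _ _ _ _ ss (fun y _ => iF y)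
    dF1 _ (fun=> normr_ge0 K) iK bF').
  exact: measurable_chart.
by apply: eq_Rintegral => u _; rewrite pE.
Qed.

Definition cosh (r : R) : R := (expR r + expR (- r)) / 2.

(** Put w(s) = s z(s). The hypothesis says w'' = r^2 w, so (w' + e r w) exp(-e r s) is constant for
    e = 1 and e = -1; this is [U e]. At s = 0 it equals z(0) because w(0) = 0, and no division by s
    occurs. *)
Lemma ode_solution (r : R) (z z' z'' : R -> R) :
  (forall s : R, is_derive s 1 z (z' s)) -> (forall s : R, is_derive s 1 z' (z'' s)) ->
  (forall s, s * z'' s = s * r ^+ 2 * z s - 2 * z' s) ->
  r * z 1 = z 0 * sinh r /\ z 1 + z' 1 = z 0 * cosh r.
Proof.
move=> dz dz' ode.
pose U e s := (z s + s * z' s + e * r * (s * z s)) * expR (- (e * r * s)).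
have dU e : e ^+ 2 = 1 -> forall s : R, is_derive s 1 (U e) 0.
  move=> e2 s.
  have D : is_derive s 1 (fun s => expR (- (e * r * s)))
    (expR (- (e * r * s)) * - (e * r)).
    apply: is_derive1_comp; apply: is_derive_eq; rewrite /GRing.scale/=; ring.
  apply: is_derive_eq; rewrite /GRing.scale/=.
  have := ode s; move: (z s) (z' s) (z'' s) (expR _) => a b c E o.
  rewrite (_ : _ + _ = E * (2 * b + s * c - e ^+ 2 * s * r ^+ 2 * a)); last ring.
  rewrite o e2; ring.
have U1 := is_derive_0_is_cst 1 0 (dU 1 (expr1n _ _)).
have UN := is_derive_0_is_cst 1 0 (dU (-1) (etrans (sqrrN 1) (expr1n _ _))).
move: U1 UN; rewrite /U !mul0r !addr0 !mulr0 !oppr0 expR0 addr0 !mulr1 !mul1r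
  !mulN1r opprK.
rewrite /sinh /cosh; have := expRN r; have := expR_gt0 r.
move: (expR r) (expR (- r)) (z 1) (z' 1) (z 0) => E E' a b c E0 E'E.
have EE : E * E' = 1 by rewrite E'E divff// gt_eqF.
(* Clearing the exponentials leaves z(1) + z'(1) + e r z(1) = z(0) exp(e r) for both signs e; half
   the difference and half the sum are the two claims. *)
move=> /(congr1 ( *%R E)) + /(congr1 ( *%R E')).
rewrite ![_ * (_ * _)]mulrC -!mulrA [E' * E]mulrC EE !mulr1 => h1 h2.
split; lra.
Qed.

End Moments.

(** * Derivatives of kappa and their signs *)

Section Kappa.
Context {R : realType}.
Implicit Types (r : R).

Lemma is_derive_expRN r : is_derive r 1 (fun s => expR (- s)) (- expR (- r)).
Proof.
rewrite -mulrN1; apply: is_derive1_comp.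
Qed.

Lemma is_derive_sinh r : is_derive r 1 sinh (cosh r).
Proof.
rewrite /sinh /cosh; have D := is_derive_expRN r.
by apply: is_derive_eq; rewrite /GRing.scale/=; field.
Qed.

Lemma is_derive_cosh r : is_derive r 1 cosh (sinh r).
Proof.
rewrite /sinh /cosh; have D := is_derive_expRN r.
by apply: is_derive_eq; rewrite /GRing.scale/=; field.
Qed.

Lemma cosh2Bsinh2 r : cosh r ^+ 2 - sinh r ^+ 2 = 1.
Proof.
have : expR r * expR (- r) = 1 by rewrite -expRD subrr expR0.
rewrite /cosh /sinh; move: (expR r) (expR (- r)) => u v uv.
by transitivity (u * v); [field|].
Qed.

Lemma sinh_gt0 r : 0 < r -> 0 < sinh r.
Proof. by move=> r0; rewrite divr_gt0// subr_gt0 ltr_expR; lra. Qed.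

Lemma cosh_gt0 r : 0 < cosh r.
Proof. by rewrite divr_gt0// addr_gt0// expR_gt0. Qed.

(** Applied to sinh s - s and to s cosh s - sinh s. The resulting inequalities are the positivity of
    kappa'' and of kappa', which make the Fisher matrix invertible. *)
Lemma derive_gt0_gt0 (f f' : R -> R) r : (forall s : R, is_derive s 1 f (f' s)) ->
  (forall s, 0 < s -> 0 < f' s) -> f 0 = 0 -> 0 < r -> 0 < f r.
Proof.
move=> df f'0 f0 r0.
have cf : {within `[0, r], continuous f}.
  apply: continuous_subspaceT => x; apply/differentiable_continuous/derivable1_diffP.
  by have [] := df x.
have [s] := MVT r0 (fun s _ => df s) cf.
rewrite in_itv/= f0 !subr0 => /andP[s0 _] ->.
by rewrite mulr_gt0// f'0.
Qed.

Lemma sinh_gt_id r : 0 < r -> r < sinh r.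
Proof.
move=> r0; rewrite -subr_gt0; move: r0.
apply: (derive_gt0_gt0 (f := fun s => sinh s - s) (f' := fun s => cosh s - 1)).
- move=> s; have D := is_derive_sinh s; exact: is_deriveB.
- move=> s s0; rewrite subr_gt0 -(@ltr_pXn2r _ 2)// ?nnegrE ?ltW ?cosh_gt0//.
  by rewrite expr1n -(cosh2Bsinh2 s) gtrBl exprn_gt0// sinh_gt0.
- by rewrite /sinh oppr0; ring.
Qed.

Lemma sinh_lt_mul_cosh r : 0 < r -> sinh r < r * cosh r.
Proof.
move=> r0; rewrite -subr_gt0; move: r0.
apply: (derive_gt0_gt0 (f := fun r => r * cosh r - sinh r) (f' := fun s => s * sinh s)).
- move=> s; have D := is_derive_sinh s; have D' := is_derive_cosh s.
  by apply: is_derive_eq; rewrite /GRing.scale/=; ring.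
- by move=> s s0; rewrite mulr_gt0// sinh_gt0.
- by rewrite /sinh oppr0; ring.
Qed.

Lemma is_derive_kappa r : 0 < r ->
  is_derive r 1 kappa (cosh r / sinh r - r^-1).
Proof.
move=> r0; have s0 := sinh_gt0 r0.
have D := is_derive_sinh r.
have L : is_derive r 1 (@ln R) r^-1 by exact: is_derive1_ln.
have S : is_derive r 1 (fun r => ln (sinh r)) ((sinh r)^-1 * cosh r).
  apply: (@is_derive1_comp _ (@ln R) sinh); exact: is_derive1_ln.
by rewrite /kappa; apply: is_derive_eq; rewrite /=; ring.
Qed.

Lemma derive1_kappa r : 0 < r -> derive1 kappa r = cosh r / sinh r - r^-1.
Proof. by move=> /is_derive_kappa[_ <-]; rewrite derive1E. Qed.

Lemma derive1_kappa_gt0 r : 0 < r -> 0 < derive1 kappa r.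
Proof.
move=> r0; have s0 := sinh_gt0 r0; rewrite derive1_kappa// subr_gt0.
by rewrite ltr_pdivlMr// ltr_pdivrMl// sinh_lt_mul_cosh.
Qed.

Lemma derive1n2_kappa r : 0 < r -> derive1n 2 kappa r = r ^- 2 - sinh r ^- 2.
Proof.
move=> r0; have s0 := sinh_gt0 r0.
have rn : r != 0 by rewrite gt_eqF. have sn : sinh r != 0 by rewrite gt_eqF.
rewrite /derive1n/= derive1E.
(* The closed form of kappa' is available for positive arguments only, so it is substituted on a
   neighbourhood of r. *)
rewrite (@near_eq_derive _ _ _ (derive1 kappa) (fun r => cosh r / sinh r - r^-1)).
- have D := is_derive_sinh r; have D' := is_derive_cosh r.
  have V : is_derive r 1 (fun r => (sinh r)^-1) (- sinh r ^- 2 *: cosh r).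
    exact: is_deriveV.
  have V' : is_derive r 1 (fun r => r^-1) (- r ^- 2 *: 1) by exact: is_deriveV.
  have [_ ->] : is_derive r 1 (fun r => cosh r / sinh r - r^-1)
      (r ^- 2 - (cosh r ^+ 2 - sinh r ^+ 2) / sinh r ^+ 2).
    by apply: is_derive_eq; rewrite /GRing.scale/=; field; apply/andP.
  by rewrite cosh2Bsinh2 mul1r.
- near=> s; apply: derive1_kappa; near: s; exact: lt_nbhsr.
Unshelve. all: by end_near. Qed.

Lemma derive1n2_kappa_gt0 r : 0 < r -> 0 < derive1n 2 kappa r.
Proof.
move=> r0; have s0 := sinh_gt0 r0.
rewrite derive1n2_kappa// subr_gt0 ltf_pV2 ?posrE ?exprn_gt0//.
by rewrite ltr_pXn2r ?nnegrE ?ltW// sinh_gt_id.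
Qed.

(** Riccati equation of the Langevin function coth r - 1/r. It is the link between second moments,
    which involve kappa' only, and the kappa'' of the Fisher matrix. *)
Lemma derive1n2_kappaE r : 0 < r ->
  derive1n 2 kappa r = 1 - derive1 kappa r ^+ 2 - 2 * derive1 kappa r / r.
Proof.
move=> r0; have s0 := sinh_gt0 r0.
have rn : r != 0 by rewrite gt_eqF. have sn : sinh r != 0 by rewrite gt_eqF.
rewrite derive1n2_kappa// derive1_kappa//.
transitivity (1 - cosh r ^+ 2 / sinh r ^+ 2 + r ^- 2); last by field; apply/andP.
rewrite (_ : cosh r ^+ 2 = 1 + sinh r ^+ 2); first by field; apply/andP.
by rewrite -(cosh2Bsinh2 r) subrK.
Qed.

Lemma expR_Nkappa r : 0 < r -> expR (- kappa r) = r / (4 * pi * sinh r).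
Proof.
move=> r0; have s0 := sinh_gt0 r0; have p0 := pi_gt0 R.
have q0 : 0 < 4 * pi :> R by rewrite mulr_gt0.
rewrite /kappa !opprD opprK !expRD !expRN !lnK ?posrE//.
by rewrite -mulrA -invfM.
Qed.

End Kappa.

(** * Normalization and first two moments of the density *)

Section VmfMoments.
Context {R : realType}.
Implicit Types (th x : 'cV[R]_3).

Lemma elementary_vmf th : elementary (vmf th).
Proof.
apply: elementary_expR; apply: elementaryD; first exact: elementary_dotvl.
exact: elementary_cst.
Qed.

Lemma vmfE th x : vmf th x = expR (- kappa (enorm th)) * expR (dotv th x).
Proof. by rewrite /vmf expRD mulrC. Qed.

(* [z s] is the integral of [exp (s th.x)]; the moment identities turn into
   [s z'' + 2 z' = s r^2 z]. *)
Lemma moment0_sinh th (r := enorm th) : th != 0 ->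
  r * moment0 th = 4 * pi * sinh r /\
  moment0 th + (th 0 0 * moment1 th 0 + th 1 0 * moment1 th 1 + th 2 0 * moment1 th 2) =
    4 * pi * cosh r.
Proof.
move=> th0.
pose l x := dotv th x; have el : elementary l by exact: elementary_dotvl.
pose z s := sphere_int (fun x => 1 * expR (s * l x)).
pose z' s := sphere_int (fun x => l x * expR (s * l x)).
pose z'' s := sphere_int (fun x => l x * (l x * expR (s * l x))).
have dz (s : R) : is_derive s 1 z (z' s).
  rewrite (_ : z' s = sphere_int (fun x => 1 * (l x * expR (s * l x)))).
    exact: is_derive_sphere_int (elementary_cst 1) el.
  by apply: eq_sphere_int => x _; rewrite mul1r.
have dz' (s : R) : is_derive s 1 z' (z'' s) by exact: is_derive_sphere_int.
have lE s x : s * l x = dotv (s *: th) x.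
  by rewrite /l !dotvE !mxE; ring.
have zE s : z s = moment0 (s *: th).
  by apply: eq_sphere_int => x _; rewrite mul1r lE.
have sum_int c0 c1 c2 (F : 'I_3 -> 'cV[R]_3 -> R) : (forall i, elementary (F i)) ->
    sphere_int (fun x => c0 * F 0 x + c1 * F 1 x + c2 * F 2 x) =
    c0 * sphere_int (F 0) + c1 * sphere_int (F 1) + c2 * sphere_int (F 2).
  move=> eF.
  have ecF c i : elementary (fun x => c * F i x).
    by apply: elementaryM => //; exact: elementary_cst.
  rewrite sphere_intD; last 2 first.
  - by apply: elementary_sphere_integrable; exact: elementaryD.
  - exact: elementary_sphere_integrable.
  rewrite sphere_intD; last 2 first.
  - exact: elementary_sphere_integrable.
  - exact: elementary_sphere_integrable.
  by rewrite !sphere_intZ//; exact: elementary_sphere_integrable.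
have z'E s : z' s = th 0 0 * moment1 (s *: th) 0 + th 1 0 * moment1 (s *: th) 1 +
    th 2 0 * moment1 (s *: th) 2.
  rewrite -(sum_int _ _ _ (fun i x => x i 0 * expR (dotv (s *: th) x))); last first.
    by move=> i; exact: elementary_moment1.
  by apply: eq_sphere_int => x _; rewrite -lE /l dotvE; ring.
have z''E s : z'' s = 
    th 0 0 * (th 0 0 * moment2 (s *: th) 0 0 + th 1 0 * moment2 (s *: th) 0 1 +
      th 2 0 * moment2 (s *: th) 0 2) +
    th 1 0 * (th 0 0 * moment2 (s *: th) 1 0 + th 1 0 * moment2 (s *: th) 1 1 +
      th 2 0 * moment2 (s *: th) 1 2) +
    th 2 0 * (th 0 0 * moment2 (s *: th) 2 0 + th 1 0 * moment2 (s *: th) 2 1 +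
      th 2 0 * moment2 (s *: th) 2 2).
  pose G i x := th 0 0 * (x i 0 * (x 0 0 * expR (dotv (s *: th) x))) +
    th 1 0 * (x i 0 * (x 1 0 * expR (dotv (s *: th) x))) +
    th 2 0 * (x i 0 * (x 2 0 * expR (dotv (s *: th) x))).
  have eG i : elementary (G i).
    by apply: elementaryD; [apply: elementaryD|]; apply: elementaryM;
      (exact: elementary_cst || exact: elementary_moment2).
  have gE i : sphere_int (G i) = th 0 0 * moment2 (s *: th) i 0 +
    th 1 0 * moment2 (s *: th) i 1 +
     th 2 0 * moment2 (s *: th) i 2.
    rewrite /G (sum_int _ _ _ (fun j x => x i 0 * (x j 0 * expR (dotv (s *: th) x))))//.
    by move=> j; exact: elementary_moment2.
  rewrite -(gE 0) -(gE 1) -(gE 2) -(sum_int _ _ _ G eG).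
  by apply: eq_sphere_int => x _; rewrite /G -lE /l dotvE; ring.
have rr : r ^+ 2 = th 0 0 ^+ 2 + th 1 0 ^+ 2 + th 2 0 ^+ 2.
  by rewrite sqr_enorm dotvE !expr2.
(* [moment2_mul] at [s *: th] already carries one factor s; pairing it with [th] gives the equation
   without dividing. *)
have ode s : s * z'' s = s * r ^+ 2 * z s - 2 * z' s.
  rewrite zE z'E z''E rr.
  have := moment2_mul (s *: th) 0; have := moment2_mul (s *: th) 1.
  have := moment2_mul (s *: th) 2; rewrite !mxE.
  move: (moment2 _) (moment1 _) (moment0 _) (th 0 0) (th 1 0) (th 2 0) =>
    M m Z t0 t1 t2 h2 h1 h0.
  move: (congr1 ( *%R t0) h0) (congr1 ( *%R t1) h1) (congr1 ( *%R t2) h2).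
  lra.
have z0 : z 0 = 4 * pi.
  by rewrite -sphere_int1; apply: eq_sphere_int => x _; rewrite mul0r expR0 mulr1.
have := ode_solution dz dz' ode.
by rewrite z0 zE z'E !scale1r.
Qed.

Lemma vmf_moment0 th : th != 0 -> sphere_int (vmf th) = 1.
Proof.
move=> th0; have r0 := enorm_gt0 th0; have s0 := sinh_gt0 r0; have p0 := pi_gt0 R.
have [Z _] := moment0_sinh th0.
have -> : sphere_int (vmf th) = expR (- kappa (enorm th)) * moment0 th.
  rewrite -sphere_intZ; last exact/elementary_sphere_integrable/elementary_exp_dotv.
  by apply: eq_sphere_int => x _; rewrite vmfE.
rewrite expR_Nkappa// mulrAC Z divff// mulf_neq0 ?gt_eqF// mulr_gt0//.
Qed.

Lemma vmf_moment1 th i (r := enorm th) : th != 0 ->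
  sphere_int (fun x => x i 0 * vmf th x) = derive1 kappa r / r * th i 0.
Proof.
move=> th0; have r0 := enorm_gt0 th0; have s0 := sinh_gt0 r0; have p0 := pi_gt0 R.
have [Z Zm] := moment0_sinh th0.
have -> : sphere_int (fun x => x i 0 * vmf th x) = expR (- kappa r) * moment1 th i.
  rewrite -sphere_intZ; last exact/elementary_sphere_integrable/elementary_moment1.
  by apply: eq_sphere_int => x _; rewrite vmfE; ring.
have rr : r ^+ 2 = th 0 0 ^+ 2 + th 1 0 ^+ 2 + th 2 0 ^+ 2.
  by rewrite sqr_enorm dotvE !expr2.
(* A vector parallel to theta is fixed by its product with theta, and that product is the second
   conclusion of [moment0_sinh]. *)
have rm : r ^+ 2 * moment1 th i = (4 * pi * cosh r - moment0 th) * th i 0.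
  rewrite -Zm rr.
  have := moment1_parallel th i 0; have := moment1_parallel th i 1.
  have := moment1_parallel th i 2.
  move: (moment1 th) (moment0 _) (th i 0) (th 0 0) (th 1 0) (th 2 0) =>
    m Z' t t0 t1 t2 h2 h1 h0.
  move: (congr1 ( *%R t0) h0) (congr1 ( *%R t1) h1) (congr1 ( *%R t2) h2).
  lra.
have -> : moment1 th i = (4 * pi * cosh r - moment0 th) * th i 0 / r ^+ 2.
  by rewrite -rm mulrAC divff ?mul1r// expf_neq0// gt_eqF.
have -> : moment0 th = 4 * pi * sinh r / r.
  by rewrite -Z mulrAC divff ?mul1r// gt_eqF.
rewrite expR_Nkappa// derive1_kappa//.
move: (@pi R) p0 => p p0; field.
by rewrite !gt_eqF.
Qed.

(** By [moment2_rotation] every row of E[x x^T] - a I is parallel to theta ([N]). Multiplying by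
    theta finds the factor: 1 - 2a from [moment2_mul], minus a for the subtracted diagonal. *)
Lemma vmf_moment2 th i j (r := enorm th) (a := derive1 kappa r / r) : th != 0 ->
  sphere_int (fun x => x i 0 * (x j 0 * vmf th x)) =
  a * (i == j)%:R + (1 - 3 * a) / r ^+ 2 * (th i 0 * th j 0).
Proof.
move=> th0; have r0 := enorm_gt0 th0.
pose E := expR (- kappa r).
have -> : sphere_int (fun x => x i 0 * (x j 0 * vmf th x)) = E * moment2 th i j.
  rewrite -sphere_intZ; last exact/elementary_sphere_integrable/elementary_moment2.
  by apply: eq_sphere_int => x _; rewrite vmfE -/r -/E; ring.
have m0 : E * moment0 th = 1.
  rewrite -(vmf_moment0 th0) -sphere_intZ.
    by apply: eq_sphere_int => x _; rewrite vmfE.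
  exact/elementary_sphere_integrable/elementary_exp_dotv.
have m1 k : E * moment1 th k = a * th k 0.
  rewrite -vmf_moment1// -sphere_intZ.
    by apply: eq_sphere_int => x _; rewrite vmfE -/r -/E; ring.
  exact/elementary_sphere_integrable/elementary_moment1.
have rr : r ^+ 2 = th 0 0 ^+ 2 + th 1 0 ^+ 2 + th 2 0 ^+ 2.
  by rewrite sqr_enorm dotvE !expr2.
have rn : r ^+ 2 != 0 by rewrite expf_neq0// gt_eqF.
have N b : (E * moment2 th i j - a * (i == j)%:R) * th b 0 =
    (E * moment2 th i b - a * (i == b)%:R) * th j 0.
  have := moment2_rotation th i j b; have := m1 j; have := m1 b.
  move: (moment2 th) (moment1 th) (E) (i == b)%:R (i == j)%:R (th b 0) (th j 0).
  move=> M m e db dj tb tj hb hj h.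
  move: (congr1 ( *%R e) h) (congr1 ( *%R db) hj) (congr1 ( *%R dj) hb); lra.
have S : E * (moment2 th i 0 * th 0 0 + moment2 th i 1 * th 1 0 +
  moment2 th i 2 * th 2 0) =
    th i 0 - 2 * (a * th i 0).
  by rewrite moment2_mul mulrBr [E * (moment0 th * _)]mulrA m0 mul1r
    [E * (2 * _)]mulrCA m1.
have D := sum3_delta i th.
suff : r ^+ 2 * (E * moment2 th i j - a * (i == j)%:R) =
    (1 - 3 * a) * (th i 0 * th j 0).
  move=> h; apply: (mulfI rn).
  rewrite mulrDr mulrCA [X in _ = _ + X]mulrA [r ^+ 2 * (_ / _)]mulrC divfK// -h; ring.
rewrite rr.
have := N 0; have := N 1; have := N 2; move: S D.
move: (E * moment2 th i j - a * (i == j)%:R) => n.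
move: (a) (E) (moment2 th i 0) (moment2 th i 1) (moment2 th i 2) => c e e0 e1 e2.
move: (i == 0)%:R (i == 1)%:R (i == 2)%:R (th 0 0) (th 1 0) (th 2 0) (th i 0) (th j 0).
move=> d0 d1 d2 t0 t1 t2 ti tj S D h2 h1 h0.
transitivity ((n * t0) * t0 + (n * t1) * t1 + (n * t2) * t2); first ring.
rewrite h0 h1 h2.
transitivity (tj * (e * (e0 * t0 + e1 * t1 + e2 * t2)) -
  tj * c * (d0 * t0 + d1 * t1 + d2 * t2)); first ring.
rewrite S D; ring.
Qed.

End VmfMoments.

(** * Score and Fisher matrix *)

Section VmfScore.
Context {R : realType}.
Implicit Types (th x : 'cV[R]_3).

Lemma has_grad_enorm th : th != 0 -> has_grad enorm th ((enorm th)^-1 *: th).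
Proof.
move=> th0.
have D : has_grad (fun y => dotv y y) th (2 *: th).
  move=> c t v ct /is_derive_colP cv; under eq_fun do rewrite dotvE.
  by apply: is_derive_eq; rewrite -ct !dotvE !mxE /GRing.scale/=; ring.
have r0 := enorm_gt0 th0.
rewrite (_ : _ *: th = (2 * Num.sqrt (dotv th th))^-1 *: (2 *: th)).
  exact: (@has_grad_comp R Num.sqrt (fun y => dotv y y) _ _ _
    (is_derive1_sqrt (dotv_gt0 th0)) D).
by rewrite scalerA invfM mulrAC mulVf// mul1r.
Qed.

Definition log_vmf x th : R := dotv th x - kappa (enorm th).

Lemma has_grad_log_vmf x th (r := enorm th) : th != 0 ->
  has_grad (log_vmf x) th (x - (derive1 kappa r / r) *: th).
Proof.
move=> th0.
have K : has_grad (fun y => kappa (enorm y)) th (derive1 kappa r *: (r^-1 *: th)).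
  apply: has_grad_comp (has_grad_enorm th0); rewrite derive1_kappa ?enorm_gt0//.
  exact/is_derive_kappa/enorm_gt0.
rewrite -scalerA => c t v ct cv.
have D1 := @has_grad_dotvr _ x th c t v ct cv; have D2 := K c t v ct cv.
rewrite /log_vmf; apply: is_derive_eq; rewrite !dotvE !mxE; ring.
Qed.

Lemma scoreE th i x (r := enorm th) : th != 0 ->
  score vmf i th x = x i 0 - derive1 kappa r / r * th i 0.
Proof.
move=> th0; rewrite /score.
rewrite (_ : (fun _ => _) = log_vmf x); last by apply/funext => y; rewrite /vmf expRK.
by rewrite (partialE _ (has_grad_log_vmf x th0)) !mxE.
Qed.

Lemma sqrtp_vmfE x th : sqrtp vmf th x = expR (2^-1 * log_vmf x th).
Proof.
rewrite /sqrtp /vmf -/(log_vmf x th).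
rewrite (_ : expR (log_vmf x th) = expR (2^-1 * log_vmf x th) ^+ 2).
  by rewrite sqrtr_sqr ger0_norm// expR_ge0.
by rewrite expr2 -expRD; congr expR; field.
Qed.

Lemma sqr_sqrtp_vmf x th : sqrtp vmf th x ^+ 2 = vmf th x.
Proof. by rewrite /sqrtp sqr_sqrtr// expR_ge0. Qed.

Lemma has_grad_sqrtp_vmf x th (r := enorm th) : th != 0 ->
  has_grad (sqrtp vmf ^~ x) th
    ((2^-1 * sqrtp vmf th x) *: (x - (derive1 kappa r / r) *: th)).
Proof.
move=> th0.
have -> : sqrtp vmf ^~ x = fun th => expR (2^-1 * log_vmf x th).
  by apply/funext => y; exact: sqrtp_vmfE.
rewrite sqrtp_vmfE.
have H : is_derive (log_vmf x th) 1 (fun s => expR (2^-1 * s))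
    (2^-1 * expR (2^-1 * log_vmf x th)).
  rewrite mulrC; apply: is_derive1_comp; apply: is_derive_eq.
  by rewrite /GRing.scale/=; ring.
exact: has_grad_comp H (has_grad_log_vmf x th0).
Qed.

Lemma dsqrtp_vmfE th i x : th != 0 ->
  dsqrtp vmf i th x = 2^-1 * score vmf i th x * sqrtp vmf th x.
Proof.
move=> th0; rewrite /dsqrtp (partialE _ (has_grad_sqrtp_vmf x th0)) scoreE// !mxE.
ring.
Qed.

(** The covariance matrix of x. The Riccati equation turns 1 - 3a - a^2 r^2 into kappa'' - a, so the
    eigenvalues are kappa'' along theta and a = kappa'/r across it. *)
Lemma fisher_vmf th i j (r := enorm th) (a := derive1 kappa r / r) : th != 0 ->
  fisher vmf th i j =
  a * (i == j)%:R + (derive1n 2 kappa r - a) / r ^+ 2 * (th i 0 * th j 0).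
Proof.
move=> th0; have r0 := enorm_gt0 th0; have ev := elementary_vmf th.
have e1 k : elementary (fun x => x k 0 * vmf th x).
  by apply: elementaryM => //; exact: elementary_coord.
have e2 : elementary (fun x => x i 0 * (x j 0 * vmf th x)).
  by apply: elementaryM => //; exact: elementary_coord.
have ec c f : elementary f -> elementary (fun x => c * f x).
  by move=> ef; apply: elementaryM => //; exact: elementary_cst.
rewrite mxE.
transitivity (sphere_int (fun x => x i 0 * (x j 0 * vmf th x) +
    (- (a * th j 0) * (x i 0 * vmf th x) + (- (a * th i 0) * (x j 0 * vmf th x) +
     (a ^+ 2 * th i 0 * th j 0) * vmf th x)))).
  by apply: eq_sphere_int => x _; rewrite !scoreE// -/r -/a; ring.
rewrite sphere_intD; [|apply: elementary_sphere_integrable..]; last 2 first.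
- exact: e2.
- by apply: elementaryD; [exact: ec|apply: elementaryD; exact: ec].
rewrite sphere_intD; [|apply: elementary_sphere_integrable..]; last 2 first.
- exact: ec.
- by apply: elementaryD; exact: ec.
rewrite sphere_intD; [|apply: elementary_sphere_integrable; exact: ec..].
rewrite !sphere_intZ; [|exact: elementary_sphere_integrable..].
rewrite vmf_moment2// !vmf_moment1// vmf_moment0// derive1n2_kappaE//.
have rn : r != 0 by rewrite gt_eqF.
rewrite -/r -/a (_ : derive1 kappa r = a * r); last by rewrite /a divfK.
by move: a => a; field.
Qed.

End VmfScore.

(** * Leibniz rule for the generator *)

Section Generator.
Context {R : realType}.
Variables (Omega : R -> 'cV[R]_3) (gamma : R) (t : R).
Implicit Types (f g : 'cV[R]_3 -> R) (th x d : 'cV[R]_3).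

Local Notation L := (generator Omega gamma t).

Lemma diffusionE x i j : diffusion gamma x i j =
  gamma ^+ 2 * ((i == j)%:R * dotv x x - x i 0 * x j 0).
Proof.
rewrite /diffusion sqr_enorm !mxE big_ord1 !mxE.
by congr (_ * (_ - _ * _)); rewrite mulr_natl.
Qed.

Lemma driftE x i : drift Omega gamma t x i 0 =
  - crossv (Omega t) x i 0 - gamma ^+ 2 * x i 0.
Proof. by rewrite /drift !mxE opprD. Qed.

Lemma generatorE f x : L f x = \sum_i drift Omega gamma t x i 0 * partial i f x +
  2^-1 * \sum_i \sum_j diffusion gamma x i j * partial j (partial i f) x.
Proof.
rewrite /generator dotvE sum3 ![grad _ _ _ _]mxE; congr (_ + _ * _).
by rewrite /mxtrace; apply: eq_bigr => i _; rewrite mxE; apply: eq_bigr => j _;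
  rewrite [hess _ _ _ _]mxE.
Qed.

Lemma partialM f g i : elementary f -> elementary g ->
  partial i (fun x => f x * g x) = fun x => f x * partial i g x + g x * partial i f x.
Proof.
move=> ef eg; apply/funext => x.
rewrite (partialE _ (has_gradM (@elementary_grad_partial _ f x ef)
  (@elementary_grad_partial _ g x eg))).
by rewrite !mxE.
Qed.

Lemma partialD f g i : elementary f -> elementary g ->
  partial i (fun x => f x + g x) = fun x => partial i f x + partial i g x.
Proof.
move=> ef eg; apply/funext => x.
rewrite (partialE _ (has_gradD (@elementary_grad_partial _ f x ef)
  (@elementary_grad_partial _ g x eg))).
by rewrite !mxE.
Qed.

(** The algebra of the Leibniz rule: symmetry of D merges the two mixed first-order sums, which
    absorbs the factor 1/2. *)
Lemma leibniz_sum (D fpp gpp : 'I_3 -> 'I_3 -> R) (b fp gp : 'I_3 -> R) (F G : R) :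
  (forall i j, D i j = D j i) ->
  \sum_i b i * (F * gp i + G * fp i) +
  2^-1 * \sum_i \sum_j D i j *
    ((F * gpp i j + gp i * fp j) + (G * fpp i j + fp i * gp j)) =
  F * (\sum_i b i * gp i + 2^-1 * \sum_i \sum_j D i j * gpp i j) +
  G * (\sum_i b i * fp i + 2^-1 * \sum_i \sum_j D i j * fpp i j) +
  \sum_i \sum_j D i j * (fp i * gp j).
Proof.
move=> DC; rewrite !sum3 (DC 1 0) (DC 2 0) (DC 2 1).
move: (D 0 0) (D 0 1) (D 0 2) (D 1 1) (D 1 2) (D 2 2) => *; by field.
Qed.

Lemma generatorM f g x : elementary f -> elementary g ->
  L (fun y => f y * g y) x = f x * L g x + g x * L f x +
  \sum_i \sum_j diffusion gamma x i j * (partial i f x * partial j g x).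
Proof.
move=> ef eg; have e := fun h i => @elementary_partial R h i.
rewrite !generatorE.
pose fg i y := f y * partial i g y + g y * partial i f y.
have p1 i : partial i (fun y => f y * g y) = fg i by exact: partialM.
have p2 i j : partial j (partial i (fun y => f y * g y)) x =
    (f x * partial j (partial i g) x + partial i g x * partial j f x) +
    (g x * partial j (partial i f) x + partial i f x * partial j g x).
  rewrite p1 /fg partialD; [|by apply: elementaryM => //; exact: e..].
  by rewrite !partialM//; exact: e.
under eq_bigr do rewrite p1 /fg.
under [X in _ + _ * X = _]eq_bigr do under eq_bigr do rewrite p2.
have D i j : diffusion gamma x i j = diffusion gamma x j i.
  by rewrite !diffusionE eq_sym [x i 0 * _]mulrC.
exact: (leibniz_sum _ _ (fun i => drift Omega gamma t x i 0)).
Qed.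

Lemma elementaryB f g : elementary f -> elementary g ->
  elementary (fun x => f x - g x).
Proof. by move=> ef eg; apply: elementaryD => //; exact: elementaryN. Qed.

Lemma elementary_crossv u i : elementary (fun x => crossv u x i 0).
Proof.
have e c j : elementary (fun x : 'cV[R]_3 => c * x j 0).
  by apply: elementaryM; [exact: elementary_cst|exact: elementary_coord].
move: i; apply: ord3P.
- by under eq_fun do rewrite mxE/=; exact: elementaryB.
- by under eq_fun do rewrite mxE/=; exact: elementaryB.
- by under eq_fun do rewrite mxE/=; exact: elementaryB.
Qed.

Lemma elementary_generator f : elementary f -> elementary (L f).
Proof.
move=> ef; have -> : L f = fun x =>
    \sum_i drift Omega gamma t x i 0 * partial i f x +
    2^-1 * \sum_i \sum_j diffusion gamma x i j * partial j (partial i f) x.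
  by apply/funext => x; exact: generatorE.
have ecst := @elementary_cst R.
have ecoord := @elementary_coord R.
have eB := elementaryB.
have esum (F : 'I_3 -> 'cV[R]_3 -> R) : (forall i, elementary (F i)) ->
    elementary (fun x => \sum_i F i x).
  move=> eF; under eq_fun do rewrite sum3.
  by apply: elementaryD => //; exact: elementaryD.
have edrift i : elementary (fun x => drift Omega gamma t x i 0).
  under eq_fun do rewrite driftE.
  apply: eB; last exact: elementaryM.
  exact/elementaryN/elementary_crossv.
have edot : elementary (fun x => dotv x x).
  under eq_fun do rewrite dotvE.
  by apply: elementaryD; [apply: elementaryD|]; apply: elementaryM.
have ediff i j : elementary (fun x => diffusion gamma x i j).
  under eq_fun do rewrite diffusionE.
  by apply: elementaryM => //; apply: eB; apply: elementaryM.
apply: elementaryD.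
  by apply: esum => i; apply: elementaryM => //; exact: elementary_partial.
apply: elementaryM => //; apply: (esum (fun i x => _)) => i.
apply: (esum (fun j x => _)) => j.
by apply: elementaryM => //; do 2 apply: elementary_partial.
Qed.

Lemma generator_coord c i x : L (fun y => y i 0 + c) x = drift Omega gamma t x i 0.
Proof.
have p j : partial j (fun y : 'cV[R]_3 => y i 0 + c) =
  fun=> (delta_mx i 0 : 'cV[R]_3) j 0.
  apply/funext => y.
  by rewrite (partialE _
    (has_gradD (@has_grad_coord R i y) (@has_grad_cst R c y))) addr0.
rewrite generatorE [X in _ + _ * X]big1 ?mulr0 ?addr0; last first.
  move=> j _; rewrite big1// => k _.
  rewrite p (_ : partial _ _ _ = 0) ?mulr0//.
  by rewrite (partialE _ (@has_grad_cst R _ x)) mxE.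
rewrite (bigD1 i)//= p [delta_mx _ _ _ _]mxE !eqxx mulr1 big1 ?addr0// => j ji.
by rewrite p [delta_mx _ _ _ _]mxE (negPf ji) mulr0.
Qed.

(** Meant for the score component times the ratio p_S / p_F. The exponential has gradient d times
    itself, so the mixed term of the Leibniz rule is row i of the diffusion matrix applied to d,
    which on the sphere is gamma^2 times the tangential part of d. *)
Lemma generator_mul_exp c c' d i x : sphere x ->
  L (fun y => (y i 0 + c) * (c' * expR (dotv d y))) x =
  (x i 0 + c) * L (fun y => c' * expR (dotv d y)) x +
  (drift Omega gamma t x i 0 + gamma ^+ 2 * (d i 0 - x i 0 * dotv x d)) *
  (c' * expR (dotv d x)).
Proof.
move=> /sphere_dotv xx.
have ew : elementary (fun y => c' * expR (dotv d y)).
  by apply: elementaryM; [exact: elementary_cst|exact: elementary_exp_dotv].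
have es : elementary (fun y : 'cV[R]_3 => y i 0 + c).
  by apply: elementaryD; [exact: elementary_coord|exact: elementary_cst].
have p j : partial j (fun y : 'cV[R]_3 => y i 0 + c) x = (j == i)%:R.
  by rewrite (partialE _
    (has_gradD (@has_grad_coord R i x) (@has_grad_cst R c x))) !mxE addr0 andbT.
have q j : partial j (fun y => c' * expR (dotv d y)) x = d j 0 * (c' * expR (dotv d x)).
  rewrite (partialE _
    (has_gradM (@has_grad_cst R c' x) (@has_grad_exp_dotv _ d x))) !mxE.
  ring.
rewrite generatorM// generator_coord.
rewrite [X in _ + X = _](_ : _ = gamma ^+ 2 * (d i 0 - x i 0 * dotv x d) *
  (c' * expR (dotv d x))).
  by rewrite [X in _ = _ + X]mulrDl addrA [_ * drift _ _ _ _ _ _]mulrC.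
rewrite (bigD1 i)//= [X in _ + X]big1 ?addr0; last first.
  by move=> j ji; rewrite big1// => k _; rewrite p (negPf ji) mul0r mulr0.
under eq_bigr do rewrite p q eqxx mul1r mulrA.
rewrite -mulr_suml; congr (_ * _).
under eq_bigr do rewrite diffusionE xx mulr1.
rewrite sum3 dotvE.
have D := sum3_delta i d.
rewrite -D; move: (i == 0)%:R (i == 1)%:R (i == 2)%:R => *; ring.
Qed.

End Generator.

(** * Inner products of the smoother field with the tangent vectors *)

Section SmootherMean.
Context {R : realType}.
Implicit Types (f g : 'cV[R]_3 -> R) (th x d : 'cV[R]_3).

Local Notation mu2 := (lebesgue_measure \x lebesgue_measure)%E.
Local Notation chart := (@sphere_chart R).

(** Needed for g an image under [Ga]. With M a bound of f, the product is dominated through |g| <= 1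
    + g^2, the weight sin u.1 being nonnegative on the rectangle. *)
Lemma sphere_L2_integrable f g : elementary f -> sphere_L2 g ->
  sphere_integrable (fun x => f x * g x).
Proof.
move=> ef [mg ig].
have [mf [M hM]] := elementary_chart_regular ef.
have ms := (@chart_regular_sin1 R).1.
have mD := @measurable_chart R.
have sin0 (u : R * R) : chart u -> 0 <= sin u.1.
  by case=> + _; rewrite /= in_itv/= => /andP[? ?]; apply: sin_ge0_pi; apply/andP.
pose dom (u : R * R) := (`|M| * (sin u.1 + g (sphere_pt u) ^+ 2 * sin u.1))%:E.
apply: (@le_integrable _ _ _ mu2 chart _ _ dom).
- exact: mD.
- apply/measurable_EFinP; apply: measurable_funM => //.
  exact: measurable_funM.
- move=> u cu; rewrite !abse_EFin lee_fin.
  have s0 := sin0 u cu.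
  rewrite [leRHS]ger0_norm; last first.
    by rewrite mulr_ge0// addr_ge0// mulr_ge0// sqr_ge0.
  rewrite !normrM (ger0_norm s0) -mulrA ler_pM ?mulr_ge0//.
    by rewrite (le_trans (hM _ cu))// ler_norm.
  rewrite -[X in _ <= X + _]mul1r -mulrDl ler_wpM2r//.
  rewrite -(real_normK (num_real (g (sphere_pt u)))).
  move: (`|g _|) => y.
  nra.
- rewrite (_ : dom = fun u =>
  (`|M|%:E * ((sin u.1)%:E + (g (sphere_pt u) ^+ 2 * sin u.1)%:E))%E).
    apply: integrableZl; first exact: mD.
    apply: integrableD; first exact: mD.
      exact: chart_regular_integrable (@chart_regular_sin1 R).
    exact: ig.
  by apply/funext => u; rewrite /dom EFinM EFinD.
Qed.

Lemma vmf_int_dotv u th (r := enorm th) : th != 0 ->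
  sphere_int (fun x => dotv u x * vmf th x) = derive1 kappa r / r * dotv u th.
Proof.
move=> th0.
have e i : elementary (fun x => x i 0 * vmf th x).
  by apply: elementaryM; [exact: elementary_coord|exact: elementary_vmf].
have ec c i : elementary (fun x => c * (x i 0 * vmf th x)).
  by apply: elementaryM => //; exact: elementary_cst.
transitivity (sphere_int (fun x => u 0 0 * (x 0 0 * vmf th x) +
    (u 1 0 * (x 1 0 * vmf th x) + u 2 0 * (x 2 0 * vmf th x)))).
  by apply: eq_sphere_int => x _; rewrite dotvE; ring.
rewrite sphere_intD; [|apply: elementary_sphere_integrable..]; last 2 first.
- exact: ec.
- by apply: elementaryD; exact: ec.
rewrite sphere_intD; [|apply: elementary_sphere_integrable; exact: ec..].
rewrite !sphere_intZ; [|exact: elementary_sphere_integrable..].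
rewrite !vmf_moment1// dotvE; ring.
Qed.

Lemma vmf_int_coord_dotv i u th (r := enorm th) (a := derive1 kappa r / r) : th != 0 ->
  sphere_int (fun x => x i 0 * (dotv u x * vmf th x)) =
  a * u i 0 + (1 - 3 * a) / r ^+ 2 * (th i 0 * dotv u th).
Proof.
move=> th0.
have e j : elementary (fun x => x i 0 * (x j 0 * vmf th x)).
  apply: elementaryM; [exact: elementary_coord|apply: elementaryM].
    exact: elementary_coord.
  exact: elementary_vmf.
have ec c j : elementary (fun x => c * (x i 0 * (x j 0 * vmf th x))).
  by apply: elementaryM => //; exact: elementary_cst.
transitivity (sphere_int (fun x => u 0 0 * (x i 0 * (x 0 0 * vmf th x)) +
    (u 1 0 * (x i 0 * (x 1 0 * vmf th x)) + u 2 0 * (x i 0 * (x 2 0 * vmf th x))))).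
  by apply: eq_sphere_int => x _; rewrite dotvE; ring.
rewrite sphere_intD; [|apply: elementary_sphere_integrable..]; last 2 first.
- exact: ec.
- by apply: elementaryD; exact: ec.
rewrite sphere_intD; [|apply: elementary_sphere_integrable; exact: ec..].
rewrite !sphere_intZ; [|exact: elementary_sphere_integrable..].
rewrite !vmf_moment2// -/r -/a dotvE.
have D := sum3_delta i u.
rewrite -D; move: (i == 0)%:R (i == 1)%:R (i == 2)%:R (a) ((1 - _) / _) => *; ring.
Qed.

Variables (Omega : R -> 'cV[R]_3) (gamma : R) (t : R).
Local Notation L := (generator Omega gamma t).

(** The required expectation evaluated with the two moments: the drift at the mean a theta, then
    gamma^2 (d - E[x x^T] d). *)
Definition smoother_mean th d i : R :=
  let r := enorm th in let a := derive1 kappa r / r in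
  - (a * crossv (Omega t) th i 0) - gamma ^+ 2 * (a * th i 0) +
  gamma ^+ 2 * (d i 0 - (a * d i 0 + (1 - 3 * a) / r ^+ 2 * (th i 0 * dotv d th))).

Lemma vmf_int_smoother_mean th d i : th != 0 ->
  sphere_int (fun x => (drift Omega gamma t x i 0 +
    gamma ^+ 2 * (d i 0 - x i 0 * dotv x d)) * vmf th x) = smoother_mean th d i.
Proof.
move=> th0.
(* The drift is linear in x, so the first moment formula integrates it; u collects its values at the
   basis vectors. *)
have [u uE] : exists u, forall x, drift Omega gamma t x i 0 = dotv u x.
  exists (\col_j drift Omega gamma t (delta_mx j 0) i 0) => x.
  rewrite dotvE ![(\col_j _) _ _]mxE !driftE.
  move: {+}i; apply: ord3P; rewrite !mxE/=; ring.
have ev := elementary_vmf th.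
have e1 : elementary (fun x => dotv u x * vmf th x).
  by apply: elementaryM => //; exact: elementary_dotvl.
have e2 : elementary (fun x => x i 0 * (dotv d x * vmf th x)).
  apply: elementaryM; first exact: elementary_coord.
  by apply: elementaryM => //; exact: elementary_dotvl.
have ec c f : elementary f -> elementary (fun x => c * f x).
  by move=> ef; apply: elementaryM => //; exact: elementary_cst.
transitivity (sphere_int (fun x => dotv u x * vmf th x +
    (gamma ^+ 2 * d i 0 * vmf th x - gamma ^+ 2 * (x i 0 * (dotv d x * vmf th x))))).
  by apply: eq_sphere_int => x _; rewrite uE [dotv x d]dotvC; ring.
rewrite sphere_intD; [|apply: elementary_sphere_integrable..]; last 2 first.
- exact: e1.
- by apply: elementaryB; exact: ec.
rewrite sphere_intB; [|apply: elementary_sphere_integrable; exact: ec..].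
rewrite !sphere_intZ; [|exact: elementary_sphere_integrable..].
rewrite vmf_int_dotv// vmf_int_coord_dotv// vmf_moment0// -uE driftE /smoother_mean /=.
ring.
Qed.

(** [Bhalf] divides by the square root of p_S and [dsqrtp] multiplies by it, each with a factor 1/2.
    With s the score and w = p_S / p_F, adjointness leaves a quarter of the integral of p_F (L(s w)
    - s L w), where the Leibniz rule cancels L w. *)
Lemma inner_Bhalf (Ga : R -> ('cV[R]_3 -> R) -> 'cV[R]_3 -> R) (thF thS : 'cV[R]_3) j :
  formal_adjoint L (Ga t) -> thS != 0 ->
  inner (Bhalf vmf (generator Omega gamma) Ga t thF (sqrtp vmf thS))
    (dsqrtp vmf j thS) =
  4^-1 * smoother_mean thS (thS - thF) j.
Proof.
move=> [L2Ga adj] th0.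
pose p := vmf thF; have ep : elementary p by exact: elementary_vmf.
have p0 x : 0 < p x by exact: expR_gt0.
pose c := - (derive1 kappa (enorm thS) / enorm thS * thS j 0).
pose c' := expR (kappa (enorm thF) - kappa (enorm thS)).
pose s (x : 'cV[R]_3) := x j 0 + c; pose w x := c' * expR (dotv (thS - thF) x).
have sE x : score vmf j thS x = s x by rewrite scoreE.
have es : elementary s.
  by apply: elementaryD; [exact: elementary_coord|exact: elementary_cst].
have ew : elementary w.
  by apply: elementaryM; [exact: elementary_cst|exact: elementary_exp_dotv].
have wp x : w x * p x = vmf thS x.
  rewrite /w /p /vmf -!expRD; congr expR; rewrite !dotvE !mxE.
  by move: (kappa _) (kappa _) => k k'; ring.
have wxE x : sqrtp vmf thS x ^+ 2 / vmf thF x = w x.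
  by rewrite sqr_sqrtp_vmf -wp mulfK// gt_eqF.
have wE : (fun x => sqrtp vmf thS x ^+ 2 / vmf thF x) = w by exact/funext.
have eLw := elementary_generator Omega gamma t ew.
have esw : elementary (fun x => s x * w x) by exact: elementaryM.
have eLsw := elementary_generator Omega gamma t esw.
have i1 : sphere_integrable (fun x => (s x * w x) * Ga t p x).
  by apply: sphere_L2_integrable => //; exact/L2Ga/elementary_C2.
have e2 : elementary (fun x => s x * (p x * L w x)).
  by apply: elementaryM => //; exact: elementaryM.
transitivity (sphere_int
  (fun x => 4^-1 * ((s x * w x) * Ga t p x - s x * (p x * L w x)))).
  apply: eq_sphere_int => x _; rewrite /Bhalf wE wxE -/p dsqrtp_vmfE// sE.
  have : 0 < sqrtp vmf thS x by rewrite sqrtp_vmfE expR_gt0.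
  move: (sqrtp vmf thS x) (Ga t p x) (L w x) (s x) (w x) (p x) => q G Lw s' w' p' q0.
  by field; rewrite gt_eqF.
have i2 := elementary_sphere_integrable e2.
have sB : sphere_integrable (fun x => (s x * w x) * Ga t p x - s x * (p x * L w x)).
  rewrite /sphere_integrable.
  rewrite (_ : (fun u => _) =
    (fun u => ((s (sphere_pt u) * w (sphere_pt u)) * Ga t p (sphere_pt u) *
      sin u.1)%:E -
     (s (sphere_pt u) * (p (sphere_pt u) * L w (sphere_pt u)) * sin u.1)%:E)%E).
    by apply: integrableB => //; exact: measurable_chart.
  by apply/funext => u; rewrite mulrBl EFinB.
rewrite sphere_intZ// sphere_intB//; congr (_ * _).
(* Adjointness is applied to the pair s w and p_F; from here on [Ga] is gone. *)
have := adj _ _ (elementary_C2 esw) (elementary_C2 ep); rewrite /inner => <-.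
rewrite -sphere_intB; last 2 first.
- by apply: elementary_sphere_integrable; exact: elementaryM.
- exact: i2.
rewrite -vmf_int_smoother_mean//; apply: eq_sphere_int => x sx.
have LE : L (fun y => s y * w y) x = s x * L w x +
    (drift Omega gamma t x j 0 +
      gamma ^+ 2 * ((thS - thF) j 0 - x j 0 * dotv x (thS - thF))) * w x.
  exact: generator_mul_exp.
rewrite LE -(wp x).
move: (L w x) (drift _ _ _ _ _ _) (dotv _ _) ((thS - thF) j 0) (w x) (p x)
  (s x) => *; ring.
Qed.

End SmootherMean.

(** * From the projected field to a velocity of theta *)

Section SmootherVelocity.
Context {R : realType}.
Variables (Omega : R -> 'cV[R]_3) (gamma : R).
Implicit Types (th x d : 'cV[R]_3) (t : R).

Definition smoother_velocity t th d : 'cV[R]_3 :=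
  let r := enorm th in
  - crossv (Omega t) th
  - (gamma ^+ 2 * derive1 kappa r / (r * derive1n 2 kappa r)) *: th
  + gain gamma th *m d.

Lemma fisher_mulE th (v : 'cV[R]_3) i (r := enorm th) (a := derive1 kappa r / r) :
  th != 0 -> (fisher vmf th *m v) i 0 =
  a * v i 0 + (derive1n 2 kappa r - a) / r ^+ 2 * (th i 0 * dotv th v).
Proof.
move=> th0; rewrite mxE sum3 !fisher_vmf// -/r -/a dotvE.
have D := sum3_delta i v.
rewrite -D; move: (i == 0)%:R (i == 1)%:R (i == 2)%:R (a) (_ / r ^+ 2) => *; ring.
Qed.

Lemma fisher_unit th : th != 0 -> fisher vmf th \in unitmx.
Proof.
move=> th0; have r0 := enorm_gt0 th0.
have A0 := derive1_kappa_gt0 r0; have K0 := derive1n2_kappa_gt0 r0.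
have rr := sqr_enorm th; rewrite dotvE in rr.
(* The matrix with the reciprocal eigenvalues: 1/kappa'' along theta and r/kappa' across it. *)
pose B : 'M[R]_3 := \matrix_(i, j) (enorm th / derive1 kappa (enorm th) * (i == j)%:R +
  ((derive1n 2 kappa (enorm th))^-1 - enorm th / derive1 kappa (enorm th)) /
    enorm th ^+ 2 *
  (th i 0 * th j 0)).
suff : fisher vmf th *m B = 1%:M by case/mulmx1_unit.
apply/matrixP => i j.
have -> : (fisher vmf th *m B) i j = (fisher vmf th *m col j B) i 0.
  by rewrite !mxE; apply: eq_bigr => k _; rewrite [col _ _ _ _]mxE.
rewrite fisher_mulE// dotvE !mxE.
have D : (0 == j)%:R * th 0 0 + (1 == j)%:R * th 1 0 + (2 == j)%:R * th 2 0 = th j 0.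
  by move: {+}j; apply: ord3P => /=; rewrite !(mul0r, mul1r, addr0, add0r).
move: A0 K0 r0 rr; move: (derive1 kappa _) => A; move: (derive1n 2 kappa _) => K;
  move: (enorm th) => r A0 K0 r0 rr.
have An : A != 0 by rewrite gt_eqF. have Kn : K != 0 by rewrite gt_eqF.
have rn : r != 0 by rewrite gt_eqF.
rewrite [X in _ * (th i 0 * X)](_ : _ = K^-1 * th j 0).
  by field; rewrite rn An Kn.
transitivity (r / A *
  ((0 == j)%:R * th 0 0 + (1 == j)%:R * th 1 0 + (2 == j)%:R * th 2 0) +
  (K^-1 - r / A) / r ^+ 2 * th j 0 *
    (th 0 0 * th 0 0 + th 1 0 * th 1 0 + th 2 0 * th 2 0)).
  ring.
by rewrite D -rr; field; rewrite Kn rn An.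
Qed.

(** The claimed velocity is verified by applying the Fisher matrix to it, which is simpler than
    applying the inverse to the expectations. *)
Lemma fisher_smoother_velocity t th d : th != 0 ->
  fisher vmf th *m smoother_velocity t th d = \col_i smoother_mean Omega gamma t th d i.
Proof.
move=> th0; have r0 := enorm_gt0 th0.
have A0 := derive1_kappa_gt0 r0; have K0 := derive1n2_kappa_gt0 r0.
have KE := derive1n2_kappaE r0.
have rr := sqr_enorm th.
pose D := dotv th d.
have vE i : smoother_velocity t th d i 0 = - crossv (Omega t) th i 0
  - (gamma ^+ 2 * derive1 kappa (enorm th) /
    (enorm th * derive1n 2 kappa (enorm th))) * th i 0
  + (gamma ^+ 2 * enorm th / derive1 kappa (enorm th) *
    (d i 0 - (enorm th ^+ 2)^-1 * D * th i 0)
    + gamma ^+ 2 * (1 - derive1 kappa (enorm th) ^+ 2) / derive1n 2 kappa (enorm th) *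
      ((enorm th ^+ 2)^-1 * D * th i 0) - gamma ^+ 2 * d i 0).
  have P : (Ppar th *m d) = ((enorm th ^+ 2)^-1 * D) *: th.
    rewrite /Ppar -scalemxAl -mulmxA -scalerA; congr (_ *: _).
    apply/matrixP => k l; rewrite !ord1 !mxE big_ord1 mulrC.
    by congr (_ * _); congr (th _ _); exact: val_inj.
  move: P; rewrite /smoother_velocity /gain /Pperp; move: (Ppar th) => Q P.
  rewrite !mulmxDl mulNmx -!scalemxAl mulmxBl P mul1mx mul_scalar_mx.
  by move: (crossv _ _) => X; rewrite !mxE.
apply/colP => i; rewrite fisher_mulE// vE [RHS]mxE /smoother_mean.
(* The component along theta: the rotation term is orthogonal to theta and the [Pperp] part of the
   gain is annihilated. *)
have -> : dotv th (smoother_velocity t th d) =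
    - (gamma ^+ 2 * derive1 kappa (enorm th) / derive1n 2 kappa (enorm th) * enorm th)
    + gamma ^+ 2 * (1 - derive1 kappa (enorm th) ^+ 2) / derive1n 2 kappa (enorm th) * D
    - gamma ^+ 2 * D.
  have X : dotv th (crossv (Omega t) th) = 0 by rewrite dotvE !mxE/=; ring.
  have sr : (enorm th ^+ 2)^-1 * D * dotv th th = D.
    by rewrite -rr mulrAC mulVf ?mul1r// expf_neq0// gt_eqF.
  transitivity (- dotv th (crossv (Omega t) th)
    - gamma ^+ 2 * derive1 kappa (enorm th) /
      (enorm th * derive1n 2 kappa (enorm th)) * dotv th th
    + (gamma ^+ 2 * enorm th / derive1 kappa (enorm th) *
      (D - (enorm th ^+ 2)^-1 * D * dotv th th)
    + gamma ^+ 2 * (1 - derive1 kappa (enorm th) ^+ 2) / derive1n 2 kappa (enorm th) *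
      ((enorm th ^+ 2)^-1 * D * dotv th th) - gamma ^+ 2 * D)).
    rewrite dotvE (vE 0) (vE 1) (vE 2).
    move: (derive1n 2 kappa (enorm th)) => K; move: (derive1 kappa (enorm th)) => A.
    move: (_ / (enorm th * K)) (_ / A) (_ / K) ((enorm th ^+ 2)^-1) => q1 q2 q3 s.
    by rewrite /D !dotvE; ring.
  rewrite X sr -rr.
  move: r0 K0; move: (derive1 kappa _) => A; move: (derive1n 2 kappa _) => K.
  move: (enorm th) => r r0 K0; move: (_ / A) => q.
  have Kn : K != 0 by rewrite gt_eqF. have rn : r != 0 by rewrite gt_eqF.
  by field; rewrite Kn rn.
rewrite [dotv d th]dotvC -/D.
move: r0 A0 K0 KE {vE rr}; move: (derive1 kappa _) => A;
  move: (derive1n 2 kappa _) => K; move: (enorm th) => r r0 A0 K0 KE.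
move: (D) (crossv (Omega t) th i 0) (th i 0) (d i 0) => D' X ti di.
have An : A != 0 by rewrite gt_eqF. have Kn : K != 0 by rewrite gt_eqF.
have rn : r != 0 by rewrite gt_eqF.
(* What remains is rational in A, K and r except for the Riccati relation, which removes the square
   of A. *)
rewrite [1 - A ^+ 2](_ : _ = K + 2 * A / r); last by rewrite KE; ring.
by field; rewrite rn An Kn.
Qed.

Lemma projection_smoother_velocity (Ga : R -> ('cV[R]_3 -> R) -> 'cV[R]_3 -> R) t
    (thF thS x : 'cV[R]_3) :
  formal_adjoint (generator Omega gamma t) (Ga t) -> thS != 0 ->
  Defs.proj vmf thS (Bhalf vmf (generator Omega gamma) Ga t thF (sqrtp vmf thS)) x =
  dotv ((2^-1 * sqrtp vmf thS x) *:
      (x - (derive1 kappa (enorm thS) / enorm thS) *: thS))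
    (smoother_velocity t thS (thS - thF)).
Proof.
move=> adj th0.
pose v := smoother_velocity t thS (thS - thF).
have vE i : 4 * \sum_j invmx (fisher vmf thS) i j *
    inner (Bhalf vmf (generator Omega gamma) Ga t thF (sqrtp vmf thS))
      (dsqrtp vmf j thS) = v i 0.
  rewrite -(mulKmx (fisher_unit th0) v) fisher_smoother_velocity// mxE mulr_sumr.
  by apply: eq_bigr => j _; rewrite mxE (inner_Bhalf _ _ adj th0); field.
rewrite /Defs.proj mulr_sumr.
under eq_bigr do rewrite -mulr_suml mulrA vE dsqrtp_vmfE// scoreE//.
rewrite -/v sum3 dotvE !mxE; ring.
Qed.

End SmootherVelocity.

(** * Equivalence of the two evolutions *)

Theorem proposition5 (R : realType) (gamma : R) (Omega : R -> 'cV[R]_3)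
    (Ga : R -> ('cV[R]_3 -> R) -> ('cV[R]_3 -> R))
    (hGa : forall t, formal_adjoint (generator Omega gamma t) (Ga t))
    (a b : R) (thF thS : R -> 'cV[R]_3)
    (thF_neq0 : forall t, t \in `]a, b[ -> thF t != 0)
    (thS_neq0 : forall t, t \in `]a, b[ -> thS t != 0)
    (hF : projection_filter vmf Ga a b thF) :
  projection_smoother vmf (generator Omega gamma) Ga a b thF thS <->
  (forall t, t \in `]a, b[ ->
    let r := enorm (thS t) in
    is_derive t 1 thS
      (- crossv (Omega t) (thS t)
       - (gamma ^+ 2 * derive1 kappa r / (r * derive1n 2 kappa r)) *: thS t
       + gain gamma (thS t) *m (thS t - thF t))).
Proof.
split=> [hS t tab|hS t tab x _]; last first.
  (* From the parameter equation to the densities: the chain rule along theta_S. *)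
  rewrite (projection_smoother_velocity _ _ (hGa t) (thS_neq0 t tab)).
  exact: has_grad_sqrtp_vmf (thS_neq0 t tab) _ _ _ erefl (hS t tab).
have th0 := thS_neq0 t tab.
change (is_derive t 1 thS (smoother_velocity Omega gamma t (thS t) (thS t - thF t))).
set v := smoother_velocity _ _ _ _ _.
pose m := (derive1 kappa (enorm (thS t)) / enorm (thS t)) *: thS t.
have dlog x : sphere x ->
    is_derive t 1 (fun s => ln (sqrtp vmf (thS s) x)) (2^-1 * dotv (x - m) v).
  move=> /(hS t tab x).
  rewrite (projection_smoother_velocity _ _ (hGa t) th0) -/m -/v => D.
  have q0 : 0 < sqrtp vmf (thS t) x by rewrite sqrtp_vmfE expR_gt0.
  have H := @is_derive1_comp _ (@ln R) (fun s => sqrtp vmf (thS s) x) _ _ _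
    (is_derive1_ln q0) D.
  suff -> : 2^-1 * dotv (x - m) v = (sqrtp vmf (thS t) x)^-1 *
      dotv ((2^-1 * sqrtp vmf (thS t) x) *: (x - m)) v by exact: H.
  move: q0; rewrite !dotvE ![(_ *: (x - m)) _ _]mxE.
  move: (sqrtp vmf _ _) (x - m) => q y q0; field; by rewrite gt_eqF.
apply/is_derive_colP => i.
(* Half the log-densities at e and -e differ by exactly the i-th coordinate of theta_S, and the
   normalizing terms also cancel in the difference of their derivatives. *)
pose e : 'cV[R]_3 := delta_mx i 0.
have ee : dotv e e = 1.
  by rewrite dotvE !mxE; move: {+}i; apply: ord3P => /=; ring.
have se : sphere e by rewrite /sphere/= /enorm ee sqrtr1.
have sNe : sphere (- e).
  have dN (y : 'cV[R]_3) : dotv (- y) (- y) = dotv y y by rewrite !dotvE !mxE; ring.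
  by rewrite /sphere/= /enorm dN ee sqrtr1.
have coordE (y : 'cV[R]_3) : y i 0 = dotv y e.
  by rewrite dotvE !mxE; move: {+}i; apply: ord3P => /=; ring.
have D1 := dlog _ se; have D2 := dlog _ sNe.
rewrite (_ : (fun s => _) = fun s => ln (sqrtp vmf (thS s) e) -
  ln (sqrtp vmf (thS s) (- e))).
  by apply: is_derive_eq; rewrite coordE !dotvE ![(_ - m) _ _]mxE ![(- e) _ _]mxE;
    field.
apply/funext => s; rewrite !sqrtp_vmfE !expRK /log_vmf coordE !dotvE ![(- e) _ _]mxE.
by move: (kappa _) => k; field.
Qed.
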